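(* Let $k$ be a positive integer and $j\in\{0,1,\dots,k\}$. Suppose $w\in W^j$ and $v\in W_j$. Then $$D_{\Lambda_j}(\mathbf{u}_{wv}) = D_{\Lambda_j}(\mathbf{u}_w)\,\mathbf{u}_v.$$
   Context: $I=\{0,1,\dots,k\}$; $i,j\in I$ are adjacent if $i-j\equiv\pm1\pmod{k+1}$. $W$ is the affine symmetric group generated by $s_i$ ($i\in I$) with $s_i^2=1$, $s_is_j=s_js_i$ (non-adjacent), $s_is_js_i=s_js_is_j$ (adjacent). $W_j$ is the subgroup generated by $\{s_i:i\ne j\}$ and $W^j$ is the set of minimal length representatives of the cosets $W/W_j$. Root datum of type $A_k^{(1)}$: simple coroots $\alpha_i^\vee$, simple roots $\alpha_i$, $\langle\alpha_i^\vee,\alpha_j\rangle=2,-1,0$ according as $i=j$, adjacent, otherwise; $W$ acts by $s_i(\lambda)=\lambda-\langle\alpha_i^\vee,\lambda\rangle\alpha_i$, $s_i(\mu)=\mu-\langle\mu,\alpha_i\rangle\alpha_i^\vee$. Fundamental weights: $\langle\alpha_i^\vee,\Lambda_j\rangle=\delta_{ij}$. For a Bruhat cover $x\lessdot y$, $x^{-1}y=us_iu^{-1}$, $\alpha_{x,y}=u(\alpha_i)$ is the positive real root with $s_{\alpha_{x,y}}=x^{-1}y$, $\alpha^\vee_{x,y}=u(\alpha_i^\vee)$. $\mathbb{A}$ is the nilCoxeter algebra with generators $\mathbf{u}_i$, relations $\mathbf{u}_i^2=0$ and the braid relations of $W$, basis $\mathbf{u}_w$ ($w\in W$). $D_{\Lambda}$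 is the linear map on $\mathbb{A}$ given by $D_\Lambda(\mathbf{u}_y)=\sum_{x\lessdot y}\langle\alpha^\vee_{x,y},\Lambda\rangle\mathbf{u}_x$. *)

(* Defs.v *)
From HB Require Import structures.
From mathcomp Require Import all_boot all_order all_algebra generic_quotient.
From mathcomp Require Import finmap monalg.
From mathcomp Require Import boolp classical_sets cardinality fsbigop.
From mathcomp Require Import ring.
From Stdlib Require Relation_Operators.

Set Implicit Arguments.
Unset Strict Implicit.
Unset Printing Implicit Defensive.

Import GRing.Theory Num.Theory.
Local Open Scope ring_scope.

(* ------------------------------------------------------------------------ *)
(* Cartan matrices: C i j is <coroot i, root j>.                            *)

Definition next_mod (k : nat) (i j : 'I_k.+1) : bool :=
  (j == i.+1 %[mod k.+1])%N.

Definition adjacent (k : nat) (i j : 'I_k.+1) : bool :=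
  next_mod i j || next_mod j i.

Definition cartan_adj (k : nat) : 'M[int]_k.+1 :=
  \matrix_(i, j) if i == j then 2 else if adjacent i j then -1 else 0.

(* Every congruence i - j = 1 and i - j = -1 mod k + 1 contributes -1: for
   k = 1 both hold and the off-diagonal entries are -2. *)
Definition cartan_cycle (k : nat) : 'M[int]_k.+1 :=
  \matrix_(i, j) ((i == j)%:Z *+ 2 - (next_mod i j)%:Z - (next_mod j i)%:Z).

(* The two matrices coincide as soon as 1 < k (cartan_cycleE below).  For k = 1
   the rule "2, -1, 0 according as equal, adjacent, otherwise", together with
   the braid relation for adjacent generators, gives cartan_adj (with the
   symmetric group S_3 as its Coxeter group), whereas the usual meaning of
   A_1^(1) is cartan_cycle (with the infinite dihedral group, no braid
   relation).  Both are admitted. *)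
Definition affine_cartan (k : nat) (C : 'M[int]_k.+1) : Prop :=
  C = cartan_adj k \/ C = cartan_cycle k.

Lemma cartan_cycleE (k : nat) : (1 < k)%N -> cartan_cycle k = cartan_adj k.
Proof.
move=> k1; apply/matrixP => i j; rewrite !mxE /adjacent.
have nn m : (0 < m < k.+1)%N ->
    forall a : nat, (a + m == a %[mod k.+1])%N = false.
  move=> /andP[m0 mk] a; rewrite -[X in _ == X %[mod _]]addn0 eqn_modDl mod0n.
  by rewrite modn_small // gtn_eqF.
have [->|ij] := eqVneq i j.
  have nj : next_mod j j = false.
    by rewrite /next_mod eq_sym -(addn1 j) nn //= ltnS ltnW.
  by rewrite nj.
case e1 : (next_mod i j); case e2 : (next_mod j i) => //=.
suff : (i + 2 == i %[mod k.+1])%N by rewrite nn // ltnS.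
by rewrite (eqP e2) -(addn1 j) -(modnDml j) (eqP e1) modnDml addn1 addn2.
Qed.

Lemma affine_cartan_diag (k : nat) (C : 'M[int]_k.+1) :
  (0 < k)%N -> affine_cartan C -> forall i, C i i = 2.
Proof.
move=> k0 [] -> i; rewrite mxE eqxx //.
suff -> : next_mod i i = false by [].
rewrite /next_mod eq_sym -(addn1 i) -[X in _ == X %[mod _]]addn0 eqn_modDl.
by rewrite mod0n modn_small.
Qed.

(* ------------------------------------------------------------------------ *)
Section CoxeterGroup.
Local Open Scope quotient_scope.
Variables (n : nat) (C : 'M[int]_n).

Inductive braid_rel : seq 'I_n -> seq 'I_n -> Prop :=
| BraidCommute i j : C i j = 0 -> C j i = 0 ->
    braid_rel [:: i; j] [:: j; i]
| BraidAdjacent i j : C i j = -1 -> C j i = -1 ->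
    braid_rel [:: i; j; i] [:: j; i; j].

Inductive coxeter_eq : seq 'I_n -> seq 'I_n -> Prop :=
| CoxRefl r : coxeter_eq r r
| CoxSym r s : coxeter_eq r s -> coxeter_eq s r
| CoxTrans r s t : coxeter_eq r s -> coxeter_eq s t -> coxeter_eq r t
| CoxSquare a b i : coxeter_eq (a ++ [:: i; i] ++ b) (a ++ b)
| CoxBraid a b r s : braid_rel r s ->
    coxeter_eq (a ++ r ++ b) (a ++ s ++ b).

Definition coxeter_eqb : rel (seq 'I_n) := fun r s => `[< coxeter_eq r s >].

Fact coxeter_eqb_refl : reflexive coxeter_eqb.
Proof. by move=> r; apply/asboolP; exact: CoxRefl. Qed.

Fact coxeter_eqb_sym : symmetric coxeter_eqb.
Proof. by move=> r s; apply/asboolP/asboolP => /CoxSym. Qed.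

Fact coxeter_eqb_trans : transitive coxeter_eqb.
Proof.
by move=> s r t /asboolP rs /asboolP st; apply/asboolP; exact: CoxTrans rs st.
Qed.

Canonical coxeter_equiv :=
  EquivRel coxeter_eqb coxeter_eqb_refl coxeter_eqb_sym coxeter_eqb_trans.

Definition coxeter := {eq_quot coxeter_equiv}.
HB.instance Definition _ := Choice.on coxeter.
HB.instance Definition _ := EqQuotient.on coxeter.

Definition of_word (r : seq 'I_n) : coxeter := \pi_coxeter r.

Lemma of_wordP (r s : seq 'I_n) : of_word r = of_word s <-> coxeter_eq r s.
Proof. by split=> [/eqmodP/asboolP|rs] //; apply/eqmodP/asboolP. Qed.

Lemma of_word_repr (x : coxeter) : of_word (repr x) = x.
Proof. exact: reprK. Qed.

Lemma coxeter_eq_cat r r' s s' :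
  coxeter_eq r r' -> coxeter_eq s s' -> coxeter_eq (r ++ s) (r' ++ s').
Proof.
have cl c t t' : coxeter_eq t t' -> coxeter_eq (c ++ t) (c ++ t').
  elim=> {t t'} [t|t t' _|t1 t2 t3 _ h1 _ h2|a b i|a b t t' h].
  - exact: CoxRefl.
  - exact: CoxSym.
  - exact: CoxTrans h1 h2.
  - by have := CoxSquare (c ++ a) b i; rewrite -!catA.
  - by have := CoxBraid (c ++ a) b h; rewrite -!catA.
have cr c t t' : coxeter_eq t t' -> coxeter_eq (t ++ c) (t' ++ c).
  elim=> {t t'} [t|t t' _|t1 t2 t3 _ h1 _ h2|a b i|a b t t' h].
  - exact: CoxRefl.
  - exact: CoxSym.
  - exact: CoxTrans h1 h2.
  - by have := CoxSquare a (b ++ c) i; rewrite -!catA.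
  - by have := CoxBraid a (b ++ c) h; rewrite -!catA.
by move=> rr' ss'; apply: CoxTrans (cr s _ _ rr') (cl r' _ _ ss').
Qed.

Lemma coxeter_eq_rev r s : coxeter_eq r s -> coxeter_eq (rev r) (rev s).
Proof.
elim=> {r s} [t|t t' _|t1 t2 t3 _ h1 _ h2|a b i|a b t t' h].
- exact: CoxRefl.
- exact: CoxSym.
- exact: CoxTrans h1 h2.
- by rewrite !rev_cat -catA; exact: CoxSquare.
- rewrite !rev_cat -!catA; apply: CoxBraid.
  by case: h => i j ij ji; [exact: BraidCommute | exact: BraidAdjacent].
Qed.

Definition coxeter_one : coxeter := of_word [::].
Definition coxeter_mul (x y : coxeter) := of_word (repr x ++ repr y).
Definition coxeter_inv (x : coxeter) := of_word (rev (repr x)).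

Lemma coxeter_mulE r s :
  coxeter_mul (of_word r) (of_word s) = of_word (r ++ s).
Proof.
by apply/of_wordP/coxeter_eq_cat; apply/of_wordP; exact: of_word_repr.
Qed.

Lemma coxeter_invE r : coxeter_inv (of_word r) = of_word (rev r).
Proof. by apply/of_wordP/coxeter_eq_rev/of_wordP; exact: of_word_repr. Qed.

Fact coxeter_mulA : associative coxeter_mul.
Proof.
move=> x y z; rewrite -(of_word_repr x) -(of_word_repr y) -(of_word_repr z).
by rewrite !coxeter_mulE catA.
Qed.

Fact coxeter_mul1 : left_id coxeter_one coxeter_mul.
Proof. by move=> x; rewrite -(of_word_repr x) coxeter_mulE. Qed.

Fact coxeter_mulx1 : right_id coxeter_one coxeter_mul.
Proof. by move=> x; rewrite -(of_word_repr x) coxeter_mulE cats0. Qed.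

Fact coxeter_mulV : left_inverse coxeter_one coxeter_inv coxeter_mul.
Proof.
move=> x; rewrite -(of_word_repr x) coxeter_invE coxeter_mulE.
apply/of_wordP; elim: (repr x) => [|i r IH]; first exact: CoxRefl.
rewrite rev_cons cat_rcons; apply: CoxTrans IH.
exact: (CoxSquare (rev r) r i).
Qed.

Fact coxeter_mulxV : right_inverse coxeter_one coxeter_inv coxeter_mul.
Proof.
move=> x; rewrite -(of_word_repr x) coxeter_invE; set r := repr x.
by rewrite -{1}(revK r) -coxeter_invE coxeter_mulV.
Qed.

HB.instance Definition _ := isGroup.Build coxeter coxeter_mulA coxeter_mul1
  coxeter_mulx1 coxeter_mulV coxeter_mulxV.

Local Open Scope group_scope.
Bind Scope group_scope with coxeter.

Definition simple_gen (i : 'I_n) : coxeter := of_word [:: i].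

Lemma of_word_cat r s : of_word (r ++ s) = of_word r * of_word s.
Proof. by rewrite -coxeter_mulE. Qed.

Lemma of_wordE r : of_word r = \prod_(i <- r) simple_gen i.
Proof.
elim: r => [|i r IH]; first by rewrite big_nil.
by rewrite big_cons -IH -[i :: r]cat1s of_word_cat.
Qed.

Fact coxeter_has_length (x : coxeter) :
  exists m, [exists r : m.-tuple 'I_n, of_word r == x].
Proof.
exists (size (repr x)); apply/existsP; exists (in_tuple (repr x)).
by rewrite of_word_repr.
Qed.

Definition ell (x : coxeter) : nat := ex_minn (coxeter_has_length x).

Fact coxeter_has_reduced (x : coxeter) :
  exists r : (ell x).-tuple 'I_n, of_word r == x.
Proof. by rewrite /ell; case: ex_minnP => m /existsP. Qed.

(* One reduced word of x, chosen once and for all. *)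
Definition reduced_word (x : coxeter) : (ell x).-tuple 'I_n :=
  xchoose (coxeter_has_reduced x).

Lemma of_reduced_word x : of_word (reduced_word x) = x.
Proof. exact/eqP/(xchooseP (coxeter_has_reduced x)). Qed.

Lemma ell_min r : (ell (of_word r) <= size r)%N.
Proof.
rewrite /ell; case: ex_minnP => m _; apply.
by apply/existsP; exists (in_tuple r).
Qed.

Inductive parabolic (j : 'I_n) : coxeter -> Prop :=
| ParabolicGen i : i != j -> parabolic j (simple_gen i)
| ParabolicOne : parabolic j 1
| ParabolicMul x y : parabolic j x -> parabolic j y -> parabolic j (x * y)
| ParabolicInv x : parabolic j x -> parabolic j x^-1.

Definition min_coset_rep (j : 'I_n) (w : coxeter) : Prop :=
  forall v, parabolic j v -> (ell w <= ell (w * v))%N.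

Definition bruhat_step (x y : coxeter) : Prop :=
  (ell x < ell y)%N /\ exists u i, y = x * (u * simple_gen i * u^-1).

Definition bruhat_le : coxeter -> coxeter -> Prop :=
  @Relation_Operators.clos_refl_trans coxeter bruhat_step.

Definition bruhat_lt (x y : coxeter) : Prop := bruhat_le x y /\ x <> y.

Definition bruhat_cover (x y : coxeter) : Prop :=
  bruhat_lt x y /\ forall z, ~ (bruhat_lt x z /\ bruhat_lt z y).

Lemma bruhat_le_ell x y : bruhat_le x y -> (ell x <= ell y)%N.
Proof.
by elim=> {x y} [x y [/ltnW]|//|x y z _ h1 _ h2] //; exact: leq_trans h1 h2.
Qed.

Lemma finite_covers y : finite_set [set x | bruhat_cover x y]%classic.
Proof.
pose words := flatten [seq [seq of_word (tval r) | r <- enum {: m.-tuple 'I_n}]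
                      | m <- iota 0 (ell y).+1].
apply: (@sub_finite_set _ _ [set` words]%classic); last exact: finite_seq.
move=> x /= [[/bruhat_le_ell xy _] _]; apply/flatten_mapP; exists (ell x).
  by rewrite mem_iota.
apply/mapP; exists (reduced_word x); first by rewrite mem_enum.
by rewrite of_reduced_word.
Qed.

Local Open Scope ring_scope.

(* Elements of the root lattice and of the coroot lattice are given by their
   coordinates in the simple roots, resp. the simple coroots; weights by their
   coordinates in the fundamental weights, that is, by their values on the
   simple coroots (a multiple of the null root does not affect these). *)
Definition simple (i : 'I_n) : 'rV[int]_n := delta_mx 0 i.

Definition pairing (mu lam : 'rV[int]_n) : int := (mu *m C *m lam^T) 0 0.

Definition weight_pairing (mu Lam : 'rV[int]_n) : int := (mu *m Lam^T) 0 0.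

Definition fund_weight (j : 'I_n) : 'rV[int]_n := delta_mx 0 j.

Definition root_refl (i : 'I_n) (lam : 'rV[int]_n) : 'rV[int]_n :=
  lam - pairing (simple i) lam *: simple i.

Definition coroot_refl (i : 'I_n) (mu : 'rV[int]_n) : 'rV[int]_n :=
  mu - pairing mu (simple i) *: simple i.

(* Computed on an arbitrary word for x; act_of_word and coact_of_word say that
   the word does not matter. *)
Definition act (x : coxeter) (lam : 'rV[int]_n) : 'rV[int]_n :=
  foldr root_refl lam (repr x).

Definition coact (x : coxeter) (mu : 'rV[int]_n) : 'rV[int]_n :=
  foldr coroot_refl mu (repr x).

Lemma pairing_simple i j : pairing (simple i) (simple j) = C i j.
Proof. by rewrite /pairing -rowE trmx_delta -colE !mxE. Qed.

Lemma weight_pairing_fund i j :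
  weight_pairing (simple i) (fund_weight j) = (i == j)%:R.
Proof. by rewrite /weight_pairing trmx_delta -colE !mxE eqxx /= eq_sym. Qed.

Lemma pairingBZl mu c j lam :
  pairing (mu - c *: simple j) lam =
    pairing mu lam - c * pairing (simple j) lam.
Proof. by rewrite /pairing !mulmxBl -!scalemxAl !mxE. Qed.

Lemma pairingBZr mu c j lam :
  pairing mu (lam - c *: simple j) = pairing mu lam - c * pairing mu (simple j).
Proof.
rewrite /pairing [(_ - _)^T]linearB /= [(_ *: _)^T]linearZ /=.
by rewrite mulmxBr -scalemxAr !mxE.
Qed.

Lemma act_of_word r lam : (forall i, C i i = 2) ->
  act (of_word r) lam = foldr root_refl lam r.
Proof.
move=> C2.
have : coxeter_eq (repr (of_word r)) r.
  by apply/of_wordP; exact: of_word_repr.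
rewrite /act; move: (repr _) => t.
elim=> {t r} [r|r s _|r s t _ -> _ ->|a b i|a b r s] //.
- rewrite !foldr_cat; congr foldr => /=.
  rewrite /root_refl; set x := foldr _ _ _.
  rewrite pairingBZr pairing_simple C2; apply/rowP => l; rewrite !mxE; ring.
- move=> rs; rewrite !foldr_cat; congr foldr; case: rs => i j ij ji /=;
    rewrite /root_refl; set x := foldr _ _ _;
    rewrite !pairingBZr !pairing_simple ?C2 ij ji; apply/rowP => l;
    rewrite !mxE; ring.
Qed.

Lemma coact_of_word r mu : (forall i, C i i = 2) ->
  coact (of_word r) mu = foldr coroot_refl mu r.
Proof.
move=> C2.
have : coxeter_eq (repr (of_word r)) r.
  by apply/of_wordP; exact: of_word_repr.
rewrite /coact; move: (repr _) => t.
elim=> {t r} [r|r s _|r s t _ -> _ ->|a b i|a b r s] //.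
- rewrite !foldr_cat; congr foldr => /=.
  rewrite /coroot_refl; set x := foldr _ _ _.
  rewrite pairingBZl pairing_simple C2; apply/rowP => l; rewrite !mxE; ring.
- move=> rs; rewrite !foldr_cat; congr foldr; case: rs => i j ij ji /=;
    rewrite /coroot_refl; set x := foldr _ _ _;
    rewrite !pairingBZl !pairing_simple ?C2 ij ji; apply/rowP => l;
    rewrite !mxE; ring.
Qed.

Definition positive (lam : 'rV[int]_n) : bool := [forall l, 0 <= lam 0 l].

(* A choice of (u, i) with x^-1 y = u s_i u^-1 and u(alpha_i) positive.  There
   may be several, but x^-1 y determines u(alpha_i) and its coroot.  One exists
   whenever x^-1 y is a reflection; the value 0 below is a dummy. *)
Definition cover_witness (x y : coxeter) : coxeter * 'I_n -> bool :=
  fun ui => (x^-1 * y == ui.1 * simple_gen ui.2 * ui.1^-1)%g &&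
            positive (act ui.1 (simple ui.2)).

Definition cover_coroot (x y : coxeter) : 'rV[int]_n :=
  if pselect (exists ui, cover_witness x y ui) is left ex
  then let ui := xchoose ex in coact ui.1 (simple ui.2) else 0.

End CoxeterGroup.

(* ------------------------------------------------------------------------ *)
Section LinearExtension.
Variables (R : comNzRingType) (K : choiceType) (V : lmodType R) (f : K -> V).

Definition lin_ext (g : {malg R[K]}) : V := \sum_(k <- msupp g) g@_k *: f k.

Lemma lin_extw (d : {fset K}) (g : {malg R[K]}) :
  (msupp g `<=` d)%fset -> lin_ext g = \sum_(k <- d) g@_k *: f k.
Proof.
move=> gd; rewrite /lin_ext; apply: big_fset_incl => // k _ /mcoeff_outdom ->.
by rewrite scale0r.
Qed.

Fact lin_ext_linear : linear lin_ext.
Proof.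
move=> c g h; pose d := (msupp g `|` msupp h `|` msupp (c *: g + h))%fset.
rewrite !(@lin_extw d).
- rewrite scaler_sumr -big_split /=; apply: eq_bigr => k _.
  by rewrite mcoeffD mcoeffZ scalerDl scalerA.
- by rewrite /d -fsetUA fsetUCA fsubsetUl.
- by rewrite /d -fsetUA fsubsetUl.
- by rewrite /d fsubsetUr.
Qed.

HB.instance Definition _ :=
  GRing.isLinear.Build R {malg R[K]} V *:%R lin_ext lin_ext_linear.

Lemma lin_extU (c : R) k : lin_ext << c *g k >> = c *: f k.
Proof. by rewrite (lin_extw msuppU_le) big_seq_fset1 mcoeffUU. Qed.

End LinearExtension.

(* ------------------------------------------------------------------------ *)
Section NilCoxeter.
Variables (R : comNzRingType) (n : nat) (C : 'M[int]_n).

Local Notation free := {malg R[{fmonom 'I_n}]}.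
Local Notation W := (coxeter C).

Definition free_gen (i : 'I_n) : free := << fmu i >>.
Definition free_word (r : seq 'I_n) : free := \prod_(i <- r) free_gen i.

(* The two-sided ideal generated by the nilCoxeter relations. *)
Inductive nil_ideal : free -> Prop :=
| NilSquare i : nil_ideal (free_gen i * free_gen i)
| NilBraid r s : braid_rel C r s -> nil_ideal (free_word r - free_word s)
| NilZero : nil_ideal 0
| NilAdd x y : nil_ideal x -> nil_ideal y -> nil_ideal (x + y)
| NilMulL a x : nil_ideal x -> nil_ideal (a * x)
| NilMulR a x : nil_ideal x -> nil_ideal (x * a).

Lemma nil_idealN x : nil_ideal x -> nil_ideal (- x).
Proof. by move=> /(NilMulL (-1)); rewrite mulN1r. Qed.

Definition nil_eqb : rel free := fun x y => `[< nil_ideal (x - y) >].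

Fact nil_eqb_refl : reflexive nil_eqb.
Proof. by move=> x; apply/asboolP; rewrite subrr; exact: NilZero. Qed.

Fact nil_eqb_sym : symmetric nil_eqb.
Proof. by move=> x y; apply/asboolP/asboolP => /nil_idealN; rewrite opprB. Qed.

Fact nil_eqb_trans : transitive nil_eqb.
Proof.
move=> y x z /asboolP xy /asboolP yz; apply/asboolP.
by rewrite -(subrKA y); exact: NilAdd.
Qed.

Local Open Scope quotient_scope.

Canonical nil_equiv := EquivRel nil_eqb nil_eqb_refl nil_eqb_sym nil_eqb_trans.

Definition nilcoxeter := {eq_quot nil_equiv}.
HB.instance Definition _ := Choice.on nilcoxeter.
HB.instance Definition _ := EqQuotient.on nilcoxeter.

Definition nil_class (x : free) : nilcoxeter := \pi_nilcoxeter x.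

Lemma nil_classP x y : nil_class x = nil_class y <-> nil_ideal (x - y).
Proof. by split=> [/eqmodP/asboolP|xy] //; apply/eqmodP/asboolP. Qed.

Lemma nil_class_repr (a : nilcoxeter) : nil_class (repr a) = a.
Proof. exact: reprK. Qed.

Lemma nil_repr x : nil_ideal (repr (nil_class x) - x).
Proof. by apply/nil_classP; exact: nil_class_repr. Qed.

Lemma nil_classW (P : nilcoxeter -> Prop) :
  (forall x, P (nil_class x)) -> forall a, P a.
Proof. by move=> h a; rewrite -(nil_class_repr a). Qed.

Definition nil_add (a b : nilcoxeter) := nil_class (repr a + repr b).
Definition nil_opp (a : nilcoxeter) := nil_class (- repr a).
Definition nil_mul (a b : nilcoxeter) := nil_class (repr a * repr b).
Definition nil_scale (c : R) (a : nilcoxeter) := nil_class (c *: repr a).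

Lemma nil_addE x y : nil_add (nil_class x) (nil_class y) = nil_class (x + y).
Proof.
by apply/nil_classP; rewrite opprD addrACA; apply: NilAdd; exact: nil_repr.
Qed.

Lemma nil_oppE x : nil_opp (nil_class x) = nil_class (- x).
Proof. by apply/nil_classP; rewrite -opprD; apply/nil_idealN/nil_repr. Qed.

Lemma nil_mulE x y : nil_mul (nil_class x) (nil_class y) = nil_class (x * y).
Proof.
apply/nil_classP; set x' := repr _; set y' := repr _.
have -> : x' * y' - x * y = (x' - x) * y' + x * (y' - y).
  by rewrite mulrBl mulrBr addrA subrK.
by apply: NilAdd; [apply: NilMulR | apply: NilMulL]; exact: nil_repr.
Qed.

Lemma nil_scaleE c x : nil_scale c (nil_class x) = nil_class (c *: x).
Proof.
apply/nil_classP; rewrite -scalerBr -mul_malgC.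
by apply: NilMulL; exact: nil_repr.
Qed.

Let nilE := (nil_addE, nil_oppE, nil_mulE, nil_scaleE).

Fact nil_addA : associative nil_add.
Proof. by do 3![elim/nil_classW=> ?]; rewrite !nilE addrA. Qed.
Fact nil_addC : commutative nil_add.
Proof. by do 2![elim/nil_classW=> ?]; rewrite !nilE addrC. Qed.
Fact nil_add0 : left_id (nil_class 0) nil_add.
Proof. by elim/nil_classW=> ?; rewrite !nilE add0r. Qed.
Fact nil_addN : left_inverse (nil_class 0) nil_opp nil_add.
Proof. by elim/nil_classW=> ?; rewrite !nilE addNr. Qed.

HB.instance Definition _ :=
  GRing.isZmodule.Build nilcoxeter nil_addA nil_addC nil_add0 nil_addN.

Fact nil_mulA : associative nil_mul.
Proof. by do 3![elim/nil_classW=> ?]; rewrite !nilE mulrA. Qed.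
Fact nil_mul1 : left_id (nil_class 1) nil_mul.
Proof. by elim/nil_classW=> ?; rewrite !nilE mul1r. Qed.
Fact nil_mulx1 : right_id (nil_class 1) nil_mul.
Proof. by elim/nil_classW=> ?; rewrite !nilE mulr1. Qed.
Fact nil_mulDl : left_distributive nil_mul +%R.
Proof.
by do 3![elim/nil_classW=> ?]; rewrite /GRing.add /= !nilE mulrDl.
Qed.
Fact nil_mulDr : right_distributive nil_mul +%R.
Proof.
by do 3![elim/nil_classW=> ?]; rewrite /GRing.add /= !nilE mulrDr.
Qed.

(* The constant coefficient vanishes on the ideal. *)
Fact nil_oner_neq0 : nil_class 1 != 0.
Proof.
apply/eqP => /nil_classP; rewrite subr0 => h.
suff : forall x : free, nil_ideal x -> mcoeff (mone : {fmonom _}) x = 0.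
  by move=> /(_ _ h)/eqP; rewrite mcoeff1 eqxx oner_eq0.
have g0 i : mcoeff (mone : {fmonom _}) (free_gen i) = 0.
  by rewrite mcoeffU1 -val_eqE /= fmU fm1.
move=> x; elim=> {x h} [i|r s rs||x y _ hx _ hy|a x _ hx|a x _ hx].
- by rewrite rmorphM /= g0 mul0r.
- rewrite mcoeffB !rmorph_prod /=.
  by case: rs => i j _ _; rewrite !big_cons !g0 !mul0r subrr.
- by rewrite mcoeff0.
- by rewrite mcoeffD hx hy addr0.
- by rewrite rmorphM /= hx mulr0.
- by rewrite rmorphM /= hx mul0r.
Qed.

HB.instance Definition _ := GRing.Zmodule_isNzRing.Build nilcoxeter
  nil_mulA nil_mul1 nil_mulx1 nil_mulDl nil_mulDr nil_oner_neq0.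

Fact nil_scaleA c d a : nil_scale c (nil_scale d a) = nil_scale (c * d) a.
Proof. by elim/nil_classW: a => ?; rewrite !nilE scalerA. Qed.
Fact nil_scale1 : left_id 1 nil_scale.
Proof. by elim/nil_classW=> ?; rewrite !nilE scale1r. Qed.
Fact nil_scaleDr : right_distributive nil_scale +%R.
Proof.
by move=> c; do 2![elim/nil_classW=> ?]; rewrite /GRing.add /= !nilE scalerDr.
Qed.
Fact nil_scaleDl a : {morph nil_scale^~ a : c d / c + d}.
Proof.
by move=> c d; elim/nil_classW: a => ?; rewrite /GRing.add /= !nilE scalerDl.
Qed.

HB.instance Definition _ := GRing.Zmodule_isLmodule.Build R nilcoxeter
  nil_scaleA nil_scale1 nil_scaleDr nil_scaleDl.

Fact nil_scaleAl (c : R) (a b : nilcoxeter) : c *: (a * b) = (c *: a) * b.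
Proof.
elim/nil_classW: a => x; elim/nil_classW: b => y.
rewrite -[LHS]/(nil_scale c (nil_mul _ _)).
rewrite -[RHS]/(nil_mul (nil_scale c _) _) !nilE.
by rewrite scalerAl.
Qed.

HB.instance Definition _ := GRing.Lmodule_isLalgebra.Build R nilcoxeter
  nil_scaleAl.

Fact free_scaleAr (c : R) (x y : free) : c *: (x * y) = x * (c *: y).
Proof.
apply/malgP => m.
rewrite [LHS]mcoeffZ.
rewrite [X in c * X = _]mcoeffMl.
rewrite [RHS](mcoeffMlw m (fsubset_refl (msupp x)) (msuppZ_le c y)).
rewrite mulr_sumr.
apply: eq_bigr => k _; rewrite mulr_sumr.
by apply: eq_bigr => l _; rewrite mcoeffZ mulrnAr mulrCA.
Qed.

Fact nil_scaleAr (c : R) (a b : nilcoxeter) : c *: (a * b) = a * (c *: b).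
Proof.
elim/nil_classW: a => x; elim/nil_classW: b => y.
rewrite -[LHS]/(nil_scale c (nil_mul _ _)).
by rewrite -[RHS]/(nil_mul _ (nil_scale c _)) !nilE free_scaleAr.
Qed.

HB.instance Definition _ := GRing.Lalgebra_isAlgebra.Build R nilcoxeter
  nil_scaleAr.

Lemma lalg_scaleAr (A : lalgType R) (a x p s : A) (c : R) :
  (forall (d : R) (y z : A), d *: (y * z) = y * (d *: z)) ->
  a * (x * (c *: p)) * s = c *: (a * x * (p * s)).
Proof. by move=> h; rewrite -!h -scalerAl !mulrA. Qed.

Lemma nil_class_linear : linear nil_class.
Proof.
by move=> c x y; rewrite -nil_addE -nil_scaleE.
Qed.

Lemma nil_class_monoid : monoid_morphism nil_class.
Proof. by split=> [|x y]; [exact: erefl | exact: esym (nil_mulE x y)]. Qed.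

HB.instance Definition _ :=
  GRing.isLinear.Build R free nilcoxeter *:%R nil_class nil_class_linear.
HB.instance Definition _ :=
  GRing.isMonoidMorphism.Build free nilcoxeter nil_class nil_class_monoid.

Definition u_gen (i : 'I_n) : nilcoxeter := nil_class (free_gen i).

(* Any other reduced word of w gives the same product. *)
Definition u_ (w : W) : nilcoxeter := \prod_(i <- reduced_word w) u_gen i.

Lemma u_gen_square i : u_gen i * u_gen i = 0.
Proof.
by rewrite -rmorphM -(rmorph0 nil_class); apply/nil_classP; rewrite subr0;
  exact: NilSquare.
Qed.

Lemma u_gen_braid r s : braid_rel C r s ->
  \prod_(i <- r) u_gen i = \prod_(i <- s) u_gen i.
Proof.
by move=> rs; rewrite -!rmorph_prod; apply/nil_classP; exact: NilBraid.
Qed.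

(* Coordinates in the basis u_: the word r goes to of_word r if it is reduced
   and to 0 otherwise. *)
Definition free_coord : free -> {malg R[W]} :=
  lin_ext (fun m : {fmonom 'I_n} =>
    if ell (of_word C m) == size m then << of_word C m >> else 0).
HB.instance Definition _ := GRing.Linear.on free_coord.

Definition coord (a : nilcoxeter) : {malg R[W]} := free_coord (repr a).

Lemma free_mul_monom (m m' : {fmonom 'I_n}) :
  (<< m >> * << m' >> : free) = << FMonom (m ++ m') >>.
Proof.
rewrite malgM_def fgmulUU mulr1; congr << _ >>; apply/val_inj.
by rewrite /= fmM.
Qed.

Lemma free_wordE r : free_word r = << FMonom r >>.
Proof.
rewrite /free_word; elim: r => [|i r IH].
  by rewrite big_nil /GRing.one /= /fgone; congr << _ >>; apply/val_inj/fm1.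
by rewrite big_cons IH free_mul_monom fmU.
Qed.

Lemma free_coord_word r : free_coord (free_word r) =
  if ell (of_word C r) == size r then << of_word C r >> else 0.
Proof. by rewrite free_wordE /free_coord lin_extU scale1r. Qed.

Lemma free_coord_ideal x : nil_ideal x -> free_coord x = 0.
Proof.
suff H : nil_ideal x -> forall r s : seq 'I_n,
    free_coord (free_word r * x * free_word s) = 0.
  by move=> /H /(_ [::] [::]); rewrite /free_word !big_nil mul1r mulr1.
have cat r s : free_word r * free_word s = free_word (r ++ s).
  by rewrite /free_word big_cat.
have mon (m : {fmonom 'I_n}) (c : R) : << c *g m >> = c *: free_word m.
  rewrite free_wordE; apply/malgP => k; rewrite mcoeffZ !mcoeffU.
  by rewrite fmK mulr_natr.
elim=> {x} [i|r' s' rs||x y _ hx _ hy|a x _ hx|a x _ hx] r s.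
- have -> : free_gen i * free_gen i = free_word [:: i; i].
    by rewrite /free_word !big_cons big_nil mulr1.
  rewrite !cat free_coord_word; case: eqP => // e.
  have : of_word C ((r ++ [:: i; i]) ++ s) = of_word C (r ++ s).
    by apply/of_wordP; rewrite -catA; exact: CoxSquare.
  move=> e'; move: (ell_min C (r ++ s)); rewrite -e' e !size_cat /=.
  by rewrite -addnA leq_add2l addnC addn2 => /ltnW; rewrite ltnn.
- rewrite mulrBr mulrBl linearB /= !cat !free_coord_word.
  have -> : of_word C ((r ++ r') ++ s) = of_word C ((r ++ s') ++ s).
    by apply/of_wordP; rewrite -!catA; exact: CoxBraid.
  have -> : size ((r ++ r') ++ s) = size ((r ++ s') ++ s).
    by rewrite !size_cat; case: rs.
  by rewrite subrr.
- by rewrite mulr0 mul0r linear0.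
- rewrite [_ * (x + y)]mulrDr [(_ + _) * _]mulrDl [LHS](raddfD free_coord).
  by apply: etrans (congr2 +%R (hx r s) (hy r s)) _; exact: addr0.
- have -> : free_word r * (a * x) * free_word s =
      \sum_(m <- msupp a) a@_m *: (free_word (r ++ m) * x * free_word s).
    rewrite {1}[a]monalgE [_ * x]mulr_suml [_ * (\sum_(_ <- _) _)]mulr_sumr.
    rewrite [LHS]mulr_suml; apply: eq_bigr => m _.
    rewrite mon -[_ *: _ * x]scalerAl -free_scaleAr -[LHS]scalerAl.
    by rewrite -cat mulrA.
  rewrite [LHS](linear_sum free_coord) big1 // => m _.
  rewrite [LHS](linearZZ free_coord).
  by apply: etrans (congr1 (GRing.scale _) (hx _ _)) _; exact: scaler0.
- have -> : free_word r * (x * a) * free_word s =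
      \sum_(m <- msupp a) a@_m *: (free_word r * x * free_word (m ++ s)).
    rewrite {1}[a]monalgE [x * _]mulr_sumr [_ * (\sum_(_ <- _) _)]mulr_sumr.
    rewrite [LHS]mulr_suml; apply: eq_bigr => m _.
    rewrite mon -(cat m s); exact: (lalg_scaleAr _ _ _ _ _ free_scaleAr).
  rewrite [LHS](linear_sum free_coord) big1 // => m _.
  rewrite [LHS](linearZZ free_coord).
  by apply: etrans (congr1 (GRing.scale _) (hx _ _)) _; exact: scaler0.
Qed.

Lemma coord_class x : coord (nil_class x) = free_coord x.
Proof.
apply/eqP; rewrite -subr_eq0 /coord -linearB; apply/eqP/free_coord_ideal.
exact: nil_repr.
Qed.

Fact coord_linear : linear coord.
Proof.
move=> c; elim/nil_classW=> x; elim/nil_classW=> y.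
by rewrite -linearP !coord_class linearP.
Qed.

HB.instance Definition _ :=
  GRing.isLinear.Build R nilcoxeter {malg R[W]} *:%R coord coord_linear.

Lemma coord_u w : coord (u_ w) = << w >>.
Proof.
rewrite /u_ -rmorph_prod coord_class free_coord_word.
by rewrite of_reduced_word size_tuple eqxx.
Qed.

(* The image of u_ y; the index set is finite by finite_covers. *)
Definition down_basis (Lam : 'rV[int]_n) (y : W) : nilcoxeter :=
  \sum_(x \in [set x : W | bruhat_cover x y]%classic)
     ((weight_pairing (cover_coroot x y) Lam)%:~R : R) *: u_ x.

Definition down (Lam : 'rV[int]_n) (a : nilcoxeter) : nilcoxeter :=
  lin_ext (down_basis Lam) (coord a).

Fact down_linear Lam : linear (down Lam).
Proof. by move=> c a b; rewrite /down !linearP. Qed.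

HB.instance Definition _ Lam :=
  GRing.isLinear.Build R nilcoxeter nilcoxeter *:%R (down Lam)
    (down_linear Lam).

Lemma down_u Lam y : down Lam (u_ y) = down_basis Lam y.
Proof. by rewrite /down coord_u lin_extU scale1r. Qed.

End NilCoxeter.

Arguments u_ R {n C} w.

(* Main.v *)
(* Let y = w v. Lengths add up, so y has a reduced word a ++ b with a a reduced
   word of w and b a word of v without the letter j. By strong exchange an
   element x covered by y is obtained by deleting one letter. If it is deleted
   from b, the coroot of the cover is the image under an element of W_j of a
   simple coroot other than that of j, so its j-th coordinate is 0. If it is
   deleted from a, then x = x' v with x' covered by w, and the coroots of the
   two covers differ by the action of v and a sign, which do not change the j-th
   coordinate since both are positive. The products of x' and v that are not
   length additive vanish in the nilCoxeter algebra.

   Strong exchange is proved by letting W act on the set of reflections with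
   signs, which requires no root system. That a product of generators of the
   nilCoxeter algebra only depends on the group element represented by a reduced
   word is Matsumoto's theorem, again by exchange. That real roots are
   positive or negative comes from the quadratic form, see cycle_form. *)

From HB Require Import structures.
From mathcomp Require Import all_boot all_order all_algebra.
From mathcomp Require Import boolp classical_sets cardinality fsbigop.
From mathcomp Require Import ring zify.
From Stdlib Require Import Relation_Operators.
Require Import Defs.

Set Implicit Arguments.
Unset Strict Implicit.
Unset Printing Implicit Defensive.

Import GRing.Theory Num.Theory.

(** * Signed reflections and strong exchange *)

Section Exchange.
Local Open Scope group_scope.
Variables (n : nat) (C : 'M[int]_n).
Local Notation W := (coxeter C).
Local Notation s := (simple_gen C).
Local Notation word := (of_word C).
Local Arguments ell {n C} x%_g.
Implicit Types (a b r : seq 'I_n) (i j : 'I_n) (u v w x y z t : W).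

Lemma of_word_nil : word [::] = 1.
Proof. by []. Qed.

Lemma of_word_cons i r : word (i :: r) = s i * word r.
Proof. by rewrite -cat1s of_word_cat. Qed.

Lemma of_word_rcons r i : word (rcons r i) = word r * s i.
Proof. by rewrite -cats1 of_word_cat. Qed.

Lemma simple_gen_sq i : s i * s i = 1.
Proof.
by rewrite -of_word_cat -of_word_nil; apply/of_wordP/(CoxSquare C [::] [::]).
Qed.

Lemma simple_genV i : (s i)^-1 = s i.
Proof. by apply/mulg1_eq/simple_gen_sq. Qed.

Lemma simple_genK i x : x * s i * s i = x.
Proof. by rewrite -mulgA simple_gen_sq mulg1. Qed.

Lemma simple_genKl i x : s i * (s i * x) = x.
Proof. by rewrite mulgA simple_gen_sq mul1g. Qed.

Lemma braid_rel_word r r' : braid_rel C r r' -> word r = word r'.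
Proof.
by move=> rr'; apply/of_wordP; have := CoxBraid [::] [::] rr'; rewrite !cats0.
Qed.

(* Parity of the number of letters of [r] whose deletion turns [word r] into
   [word r * t]. It only depends on [word r]. *)
Fixpoint flips r t : bool :=
  if r is i :: r' then (t == s i ^ word r') (+) flips r' t else false.

Lemma eq_conjV t x y : (t ^ x^-1 == y) = (t == y ^ x).
Proof. exact: (can2_eq (conjgKV x) (conjgK x)). Qed.

Lemma flips_cat a b t :
  flips (a ++ b) t = flips a (t ^ (word b)^-1) (+) flips b t.
Proof.
elim: a => //= i a ->; rewrite addbA; congr ((_ (+) _) (+) _).
by rewrite of_word_cat conjgM eq_conjV.
Qed.

(** Each letter of a word contributes one reflection. A square contributes the same reflection
    twice, and the two sides of a braid relation contribute the same reflections in opposite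
    orders. *)
Lemma coxeter_eq_flips a b : coxeter_eq C a b -> flips a =1 flips b.
Proof.
elim=> {a b} [//|r r' _ h t|r1 r2 r3 _ h1 _ h2 t|a b i t|a b r r' rr' t].
- by rewrite h.
- by rewrite h1.
- rewrite !flips_cat of_word_cat !of_word_cons of_word_nil ?mulg1.
    rewrite simple_gen_sq mul1g /= !of_word_cons of_word_nil mulg1 conjg1.
  rewrite (conjgE (s i)) simple_gen_sq.
  by rewrite mulg1 simple_genV addbF addbb addFb.
- rewrite !flips_cat !of_word_cat -(braid_rel_word rr').
  congr (_ (+) (_ (+) _)).
  move: (t ^ _) => t'; case: rr' (braid_rel_word rr') => {r r'} i j _ _;
    rewrite /= !of_word_cons of_word_nil !mulg1 !conjg1 !addbF => e.
    have ei : s i ^ s j = s i by rewrite conjgE e mulKg.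
    have ej : s j ^ s i = s j by rewrite conjgE -e mulKg.
    by rewrite ei ej addbC.
  have ej : s i ^ (s j * s i) = s j.
    by rewrite conjgE invgM !simple_genV -!mulgA e !simple_genKl.
  have ei : s j ^ (s i * s j) = s i.
    by rewrite conjgE invgM !simple_genV -!mulgA -e !simple_genKl.
  have e' : s i ^ s j = s j ^ s i by rewrite !conjgE !simple_genV e.
  by rewrite ej ei e' addbC addbA [(t' == s i) (+) _]addbC -addbA addbA.
Qed.

(** For a reflection [t], this says that [t] is a right inversion of [x]; see [ell_mul_refl]. *)
Definition invb x t : bool := flips (repr x) t.

Lemma invb_word r t : invb (word r) t = flips r t.
Proof. by apply: coxeter_eq_flips; apply/of_wordP; exact: of_word_repr. Qed.

Lemma invbM x y t : invb (x * y) t = invb x (t ^ y^-1) (+) invb y t.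
Proof.
rewrite -(of_word_repr x) -(of_word_repr y) -of_word_cat.
by rewrite !invb_word flips_cat.
Qed.

Lemma invb1 t : invb 1 t = false.
Proof. by rewrite (invb_word [::]). Qed.

Lemma invb_gen i t : invb (s i) t = (t == s i).
Proof. by rewrite (invb_word [:: i]) /= conjg1 addbF. Qed.

Definition reflection t : Prop := exists u i, t = s i ^ u.

Lemma reflection_gen i : reflection (s i).
Proof. by exists 1, i; rewrite conjg1. Qed.

Lemma reflectionJ t u : reflection t -> reflection (t ^ u).
Proof. by move=> [v [i ->]]; exists (v * u), i; rewrite conjgM. Qed.

Lemma reflection_sq t : reflection t -> t * t = 1.
Proof. by move=> [u [i ->]]; rewrite -conjMg simple_gen_sq conj1g. Qed.

(** By the cocycle rule [invbM], the factors [u^-1], [s i] and [u] contribute separately. The outer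
    two cancel because [invb 1] vanishes. *)
Lemma invb_self t : reflection t -> invb t t.
Proof.
move=> [u [i ->]]; rewrite {1}conjgE.
rewrite invbM (invbM (s i)) conjgK.
have -> : (s i ^ u) ^ (s i * u)^-1 = s i.
  by rewrite invgM conjgM conjgK simple_genV conjgE mulKg.
have /esym := invbM u^-1 u (s i ^ u); rewrite mulVg invb1 conjgK.
by rewrite invb_gen eqxx; case: (invb u^-1 _); case: (invb u _).
Qed.

Lemma invb_mul_refl y t : reflection t -> invb (y * t) t = ~~ invb y t.
Proof.
move=> rt; rewrite invbM invb_self // addbT; congr (~~ invb y _).
by rewrite conjgE invgK mulgA mulgK.
Qed.

Lemma flips_deletion r t : flips r t ->
  exists a i b, [/\ r = a ++ i :: b, t = s i ^ word b
                  & word r * t = word (a ++ b)].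
Proof.
elim: r => //= i r IH; case: eqVneq => [-> _|_ /IH [a [k [b [-> tk e]]]]].
  exists [::], i, r; split=> //.
  rewrite of_word_cons conjgE !mulgA. by rewrite mulgK simple_gen_sq mul1g.
exists (i :: a), k, b; split=> //=.
by rewrite !of_word_cons -mulgA e.
Qed.

(** * Reduced words and length *)

Definition reduced r : bool := ell (word r) == size r.

Lemma reduced_word_reduced x : reduced (reduced_word x).
Proof. by rewrite /reduced of_reduced_word size_tuple. Qed.

Lemma ell1 : ell (1 : W) = 0%N.
Proof. by apply/eqP; rewrite -leqn0 -of_word_nil ell_min. Qed.

Lemma ell_mul x y : (ell (x * y) <= ell x + ell y)%N.
Proof.
rewrite -{1}(of_reduced_word x) -{1}(of_reduced_word y) -of_word_cat.
by apply: leq_trans (ell_min _ _) _; rewrite size_cat !size_tuple.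
Qed.

Lemma ell_gen i : (ell (s i) <= 1)%N.
Proof. exact: ell_min. Qed.

Lemma reduced_catl a b : reduced (a ++ b) -> reduced a.
Proof.
rewrite /reduced of_word_cat size_cat => /eqP e; rewrite eqn_leq ell_min /=.
by have := ell_mul (word a) (word b); have := ell_min C b; lia.
Qed.

Lemma reduced_catr a b : reduced (a ++ b) -> reduced b.
Proof.
rewrite /reduced of_word_cat size_cat => /eqP e; rewrite eqn_leq ell_min /=.
by have := ell_mul (word a) (word b); have := ell_min C a; lia.
Qed.

(** An inversion [t] of [y] deletes a letter from a reduced word of [y]. If [t] is not an inversion
    of [y], it is one of [y * t], and the same argument applies there. *)
Lemma ell_mul_refl y t : reflection t -> (ell (y * t) < ell y)%N = invb y t.
Proof.
have lt x : invb x t -> (ell (x * t) < ell x)%N.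
  rewrite -{1}(of_reduced_word x) invb_word => /flips_deletion[a [i [b [e _]]]].
  rewrite of_reduced_word => ->; rewrite -(size_tuple (reduced_word x)) e.
  by apply: leq_ltn_trans (ell_min _ _) _; rewrite !size_cat /= addnS.
move=> rt; apply/idP/idP => [|/lt //]; apply: contraTT => h.
have /lt : invb (y * t) t by rewrite invb_mul_refl.
by rewrite -mulgA reflection_sq // mulg1 -leqNgt => /ltnW.
Qed.

Lemma strong_exchange r t :
  reflection t -> (ell (word r * t) < ell (word r))%N ->
  exists a i b, [/\ r = a ++ i :: b, t = s i ^ word b
                  & word r * t = word (a ++ b)].
Proof. by move=> rt; rewrite ell_mul_refl // invb_word => /flips_deletion. Qed.

Lemma left_exchange r i : (ell (s i * word r) < ell (word r))%N ->
  exists a k b, r = a ++ k :: b /\ s i * word r = word (a ++ b).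
Proof.
rewrite (conjgC (s i)) => h.
have [a [k [b [-> _ e]]]] :=
  strong_exchange (reflectionJ (word r) (reflection_gen i)) h.
by exists a, k, b.
Qed.

(** [s i] is an inversion of exactly one of [x] and [x * s i]. *)
Lemma ell_gen_neq x i : ell (x * s i) <> ell x.
Proof.
have := ell_mul_refl (x * s i) (reflection_gen i).
have := ell_mul_refl x (reflection_gen i).
rewrite invb_mul_refl ?simple_genK; last exact: reflection_gen.
by case: (invb x _) => /=; lia.
Qed.

Lemma ell_mul_gen x i :
  ell (x * s i) = (ell x).+1 \/ ell x = (ell (x * s i)).+1.
Proof.
have := @ell_gen_neq x i; have := ell_mul x (s i).
by have := ell_mul (x * s i) (s i); rewrite simple_genK; have := ell_gen i; lia.
Qed.

(** * The Bruhat order and its covers *)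

Definition refl_cover x y : Prop :=
  ell y = (ell x).+1 /\ exists2 t, reflection t & y = x * t.

Local Notation chain := (clos_refl_trans_1n W refl_cover).

Lemma chain_trans x y z : chain x y -> chain y z -> chain x z.
Proof. by elim=> {x y} // x u y xu _ IH /IH; exact: rt1n_trans. Qed.

Lemma chain1 x y : refl_cover x y -> chain x y.
Proof. by move=> xy; apply: rt1n_trans xy _; exact: rt1n_refl. Qed.

Lemma chain_ell x y : chain x y -> (ell x <= ell y)%N.
Proof. by elim=> {x y} // x u y [lu _] _; apply: leq_trans; rewrite lu. Qed.

Lemma refl_cover_gen x i : (ell x < ell (x * s i))%N -> refl_cover x (x * s i).
Proof.
move=> h; split; first by have := ell_mul_gen x i; lia.
by exists (s i) => //; exact: reflection_gen.
Qed.

(** Conjugation by [s i] carries the inversions of [y] other than [s i] to inversions of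
    [y * s i]. *)
Lemma mul_refl_gen y t i :
  reflection t -> t <> s i -> (ell (y * t) < ell y)%N ->
  (ell (y * t * s i) < ell (y * s i))%N.
Proof.
move=> rt ti; rewrite ell_mul_refl // => yt.
have -> : y * t * s i = y * s i * t ^ s i.
  by rewrite conjgE simple_genV !mulgA simple_genK.
rewrite ell_mul_refl; last exact: reflectionJ.
move: yt; rewrite -{1}(simple_genK i y) invbM simple_genV invb_gen.
by case: eqP => // _; rewrite addbF.
Qed.

(** This is the lifting property. The steps of the chain are conjugated by [s i] up to the first
    element that [s i] shortens. *)
Lemma chain_lift i x y : chain x y -> (ell x < ell (x * s i))%N ->
  (ell y < ell (y * s i))%N -> chain (x * s i) (y * s i).
Proof.
elim=> {x y} [x _ _|x z y [lz [t rt zE]] zy IH xs ys]; first exact: rt1n_refl.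
have lxs : ell (x * s i) = (ell x).+1 by have := ell_mul_gen x i; lia.
have [zs|/negP zs] := boolP (ell z < ell (z * s i))%N.
  apply: rt1n_trans (IH zs ys); split; first by have := ell_mul_gen z i; lia.
  exists (t ^ s i); first exact: reflectionJ.
  by rewrite zE conjgE simple_genV !mulgA simple_genK.
(* Here [s i] shortens [z]. If [t] were not [s i], [mul_refl_gen] would make [x * s i] shorter than
   [z * s i], against the lengths. *)
suff -> : x * s i = z by apply: chain_trans zy (chain1 (refl_cover_gen ys)).
have [<-//|/eqP ti] := eqVneq t (s i).
have ztx : z * t = x by rewrite zE -mulgA reflection_sq // mulg1.
have := mul_refl_gen rt ti (y := z); rewrite ztx.
by have := ell_mul_gen z i; lia.
Qed.

(** Induction on the length of [y = x * t]: a right descent [s i] of [y] reduces the claim to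
    [x * s i] and [y * s i]. *)
Lemma refl_lt_chain x t : reflection t -> (ell x < ell (x * t))%N ->
  chain x (x * t).
Proof.
move: {2}(ell (x * t)) (leqnn (ell (x * t))) => m.
elim: m x t => [|m IH] x t; first by lia.
set y := x * t => ym rt xy.
have ytx : y * t = x by rewrite /y -mulgA reflection_sq // mulg1.
have [i yi] : exists i, (ell (y * s i) < ell y)%N.
  have := of_reduced_word y; have := reduced_word_reduced y.
  case/lastP: (tval (reduced_word y)) => [_ y1|r i red e].
    by move: xy; rewrite -y1 of_word_nil ell1.
  exists i; rewrite -e of_word_rcons simple_genK -of_word_rcons.
  by rewrite (eqP red) size_rcons ltnS ell_min.
have yE := simple_genK i y.
have ysy : refl_cover (y * s i) y.
  by rewrite -{2}yE; apply: refl_cover_gen; rewrite yE.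
have [ti|/eqP ti] := eqVneq t (s i).
  by apply: chain1; rewrite -ytx ti.
have xys : (ell (x * s i) < ell (y * s i))%N.
  by rewrite -{1}ytx; apply: mul_refl_gen; rewrite ?ytx.
have yst : x * s i * t ^ s i = y * s i.
  by rewrite conjgE simple_genV !mulgA simple_genK.
have ch : chain (x * s i) (y * s i).
  rewrite -yst; apply: IH; rewrite ?yst //; first by lia.
  exact: reflectionJ.
(* If [s i] shortens [x], the chain is lifted. Otherwise it is extended at both ends, by the covers
   from [x] to [x * s i] and from [y * s i] to [y]. *)
have [xs|/negP xs] := boolP (ell (x * s i) < ell x)%N.
  by have := @chain_lift i _ _ ch; rewrite !simple_genK; apply.
apply: rt1n_trans (chain_trans ch (chain1 ysy)).
by apply: refl_cover_gen; have := ell_mul_gen x i; lia.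
Qed.

Lemma bruhat_stepP x y : bruhat_step x y <->
  (ell x < ell y)%N /\ exists2 t, reflection t & y = x * t.
Proof.
split=> -[xy].
  move=> [u [i yE]]; split=> //; exists (u * s i * u^-1) => //.
  by exists u^-1, i; rewrite conjgE invgK mulgA.
move=> [t [u [i ->]] yE]; split=> //; exists u^-1, i.
by rewrite yE conjgE invgK !mulgA.
Qed.

Lemma bruhat_le_chain x y : bruhat_le x y -> chain x y.
Proof.
elim=> {x y} [x y /bruhat_stepP[xy [t rt yE]]|x|x y z _ xy _ yz].
- by rewrite yE in xy *; exact: refl_lt_chain.
- exact: rt1n_refl.
- exact: chain_trans xy yz.
Qed.

Lemma refl_cover_le x y : refl_cover x y -> bruhat_le x y.
Proof.
move=> [lxy [t rt yE]]; apply/rt_step/bruhat_stepP.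
by split; [rewrite lxy | exists t].
Qed.

Lemma bruhat_lt_ell x y : bruhat_lt x y -> (ell x < ell y)%N.
Proof.
move=> [/bruhat_le_chain ch xy]; case: ch xy => // z y' [lz _] zy' _.
by rewrite -lz chain_ell.
Qed.

(** A Bruhat relation refines to a chain of steps that raise the length by one; a cover leaves room
    for a single step. *)
Lemma bruhat_coverP x y : bruhat_cover x y <-> refl_cover x y.
Proof.
split=> [[[/bruhat_le_chain ch xy] nb]|xy].
  case: ch xy nb => // z y' xz zy' _ nb.
  have [<-//|/eqP zy] := eqVneq z y'; case: (nb z); split; split=> //.
  - exact: refl_cover_le.
  - by case: xz => lz _ xz; move: lz; rewrite xz; lia.
  - elim: zy' {zy nb xz} => [?|a b c ab _]; first exact: rt_refl.
    exact/rt_trans/refl_cover_le.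
split; first split; first exact: refl_cover_le.
  by case: xy => lxy _ xy; move: lxy; rewrite xy; lia.
case: xy => lxy _ z [/bruhat_lt_ell + /bruhat_lt_ell]; lia.
Qed.

(** * Parabolic subgroups and minimal coset representatives *)

Lemma cat_eq_cat_cons (T : Type) (a b c d : seq T) k : a ++ b = c ++ k :: d ->
  (exists2 c', c = a ++ c' & b = c' ++ k :: d) \/
  (exists2 d', a = c ++ k :: d' & d = d' ++ b).
Proof.
elim: a c => [|l a IH] [|l' c] /=; try by left; exists [::].
- by move=> ->; left; exists (l' :: c).
- by move=> [-> <-]; right; exists a.
move=> [-> /IH[[c' -> ->]|[d' -> ->]]]; first by left; exists c'.
by right; exists d'.
Qed.

(** [a] is the longest reduced prefix; the next letter changes the length by one and does not raise
    it. *)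
Lemma not_reduced_prefix r : ~~ reduced r -> exists a i b,
  [/\ r = a ++ i :: b, reduced a & (ell (word a * s i) < ell (word a))%N].
Proof.
elim/last_ind: r => [|r i IH]; first by rewrite /reduced of_word_nil ell1.
have [red nred|/IH[a [k [b [-> ra ak]]]] _] := boolP (reduced r); last first.
  by exists a, k, (rcons b i); rewrite rcons_cat.
exists r, i, [::]; rewrite cats1; split=> //; move: nred; rewrite /reduced.
rewrite of_word_rcons size_rcons -(eqP red).
by have := ell_mul_gen (word r) i; lia.
Qed.

Lemma parabolic_word j v : parabolic j v ->
  exists2 r, j \notin r & v = word r.
Proof.
elim=> {v} [i ij||x y _ [a ja ->] _ [b jb ->]|x _ [a ja ->]].
- by exists [:: i]; rewrite ?inE 1?eq_sym.
- by exists [::].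
- by exists (a ++ b); rewrite ?mem_cat ?negb_or ?ja // of_word_cat.
- by exists (rev a); rewrite ?mem_rev //; exact: coxeter_invE.
Qed.

Lemma word_parabolic j r : j \notin r -> parabolic j (word r).
Proof.
elim: r => [_|i r IH]; first exact: ParabolicOne.
rewrite inE negb_or of_word_cons => /andP[ij /IH]; apply: ParabolicMul.
by apply: ParabolicGen; rewrite eq_sym.
Qed.

(** The minimum is over words without [j] only; that the word is reduced in the whole group is not
    yet known here. *)
Lemma shortest_parabolic_word j v : parabolic j v -> exists r,
  [/\ j \notin r, v = word r
    & forall r', j \notin r' -> v = word r' -> (size r <= size r')%N].
Proof.
move=> /parabolic_word[r jr vr].
pose P m := `[< exists2 r', j \notin r' /\ v = word r' & size r' = m >].
have exP : exists m, P m by exists (size r); apply/asboolP; exists r.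
case: (ex_minnP exP) => m /asboolP[a [ja va] <-] mmin; exists a; split=> //.
by move=> r' jr' vr'; apply: mmin; apply/asboolP; exists r'.
Qed.

(** If the concatenation were not reduced, the first letter [i] that lowers the length would cancel
    against an earlier letter, contradicting the minimality of [r] or of [w]. *)
Lemma min_coset_rep_reduced j w v : min_coset_rep j w -> parabolic j v ->
  exists2 r, j \notin r & v = word r /\ reduced (reduced_word w ++ r).
Proof.
move=> wmin /shortest_parabolic_word[r [jr vr rmin]].
exists r => //; split=> //.
have : reduced (reduced_word w) by exact: reduced_word_reduced.
have := of_reduced_word w; set a := tval _ => wa ra.
apply: contraT => /not_reduced_prefix[c [i [d [e rc lt]]]].
case: (cat_eq_cat_cons e) => [[b cE rE]|[d' aE _]]; last first.
  have : reduced (rcons c i).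
    by apply: (@reduced_catl _ d'); rewrite cat_rcons -aE.
  by rewrite /reduced of_word_rcons size_rcons -(eqP rc) => /eqP; lia.
move: jr; rewrite rE mem_cat inE !negb_or => /and3P[jb ij jd].
have [c1 [k [c2 [c12 _]]]] := strong_exchange (reflection_gen i) lt.
rewrite cE in c12 *; case: (cat_eq_cat_cons c12) => [[b1 -> bE]|[a' aE ->]].
  (* The cancelled letter lies in [r]: deleting it together with [i] leaves a shorter word of [v]
     without [j]. *)
  rewrite -catA !of_word_cat -mulgA => /mulgI; rewrite -of_word_cat => ck.
  have jbd : j \notin b1 ++ c2 ++ d.
    move: jb; rewrite bE !mem_cat inE !negb_or jd andbT.
    by case/and3P=> -> _ ->.
  have := rmin _ jbd; rewrite vr rE of_word_cat of_word_cons mulgA ck.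
  rewrite catA (of_word_cat _ _ d) => /(_ erefl); rewrite bE !size_cat /=; lia.
(* The cancelled letter lies in the word of [w]: the element [w * word b * s i * (word b)^-1] of the
   same coset is shorter than [w]. *)
rewrite catA 2!of_word_cat => ck.
have : parabolic j (word (b ++ i :: rev b)).
  by apply: word_parabolic; rewrite mem_cat inE mem_rev !negb_or jb ij.
move=> /wmin; rewrite -wa of_word_cat of_word_cons.
have -> : word (rev b) = (word b)^-1 by exact/esym/coxeter_invE.
rewrite !mulgA ck mulgK (eqP ra) aE.
by have := ell_min C (c1 ++ a'); rewrite !size_cat /=; lia.
Qed.

Lemma min_coset_rep_ell j w v : min_coset_rep j w -> parabolic j v ->
  ell (w * v) = (ell w + ell v)%N.
Proof.
move=> wmin /(min_coset_rep_reduced wmin)[r _ [-> /[dup]]].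
rewrite {1}/reduced of_word_cat of_reduced_word size_cat size_tuple => /eqP ->.
by move=> /reduced_catr /eqP ->.
Qed.

End Exchange.

(** * Matsumoto's theorem *)

Section WordProperty.
Local Open Scope group_scope.
Variables (n : nat) (C : 'M[int]_n).
Hypothesis C2 : forall i, C i i = 2%R.
Local Notation W := (coxeter C).
Local Notation s := (simple_gen C).
Local Notation word := (of_word C).
Local Notation reduced := (reduced C).
Local Arguments ell {n C} x%_g.
Implicit Types (a b c d p q r : seq 'I_n) (i j : 'I_n) (u v w x y z t : W).

(** The [i]-th coordinate of the simple root [i] becomes -1 under [s i] but stays 1 under [s j]. *)
Lemma simple_gen_inj : injective s.
Proof.
move=> i j ij; apply/eqP; apply: contraT => nij.
have /rowP/(_ i) : act (s i) (simple i) = act (s j) (simple i) by rewrite ij.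
rewrite /simple_gen !act_of_word //= /root_refl !pairing_simple C2.
rewrite !mxE !eqxx /=.
by rewrite (negPf nij) mulr0.
Qed.

(* Free reduction, by cancellation of equal neighbours: a normal form when
   there are no braid relations. *)
Definition push i r : seq 'I_n :=
  if r is k :: r' then if i == k then r' else i :: r else [:: i].

Lemma push_push i r : sorted (fun k l => k != l) r -> push i (push i r) = r.
Proof.
case: r => [|k [|l r]] /=; rewrite ?eqxx //; case: (eqVneq i k) => [->|_] //=;
  rewrite ?eqxx //.
by case/andP=> /negPf ->.
Qed.

Lemma push_sorted i r : sorted (fun k l => k != l) r ->
  sorted (fun k l => k != l) (push i r).
Proof.
case: r => //= k r; case: (eqVneq i k) => [_|ik]; first exact: path_sorted.
by rewrite /= ik.
Qed.

Lemma free_reduction_eq a b : (forall r r', ~ braid_rel C r r') ->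
  coxeter_eq C a b -> foldr push [::] a = foldr push [::] b.
Proof.
move=> nobraid; elim=> {a b} // [r1 r2 r3 _ -> _ ->|a b i|a b r r' /nobraid] //.
rewrite !foldr_cat /= push_push //.
by elim: b => //= k b; exact: push_sorted.
Qed.

Lemma word_free_reduction r : word (foldr push [::] r) = word r.
Proof.
elim: r => //= i r; rewrite of_word_cons => <-.
case: (foldr _ _ r) => [|k r'] /=; first by rewrite of_word_cons.
case: eqVneq => [->|_]; rewrite !of_word_cons //.
by rewrite simple_genKl.
Qed.

Lemma reduced_free_reduction r : reduced r -> foldr push [::] r = r.
Proof.
move=> rr; have : (size r <= size (foldr push [::] r))%N.
  by rewrite -(eqP rr) -word_free_reduction ell_min.
elim: r {rr} => //= i r IH.
have {IH} : (size (foldr push [::] r) <= size r)%N /\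
  ((size r <= size (foldr push [::] r))%N -> foldr push [::] r = r).
  split=> //; elim: r {IH} => //= k r; case: (foldr _ _ r) => //= l r'.
  by case: ifP => /=; lia.
case: (foldr _ _ r) => [|k r'] /= [le h]; first by move=> ?; rewrite -h.
case: ifP => /= _ ge; first by lia.
by rewrite h.
Qed.

Definition braid_invariant (T : Type) (f : seq 'I_n -> T) : Prop :=
  forall a b r r', braid_rel C r r' -> f (a ++ r ++ b) = f (a ++ r' ++ b).

Lemma braid_invariant_cons (T : Type) (f : seq 'I_n -> T) i :
  braid_invariant f -> braid_invariant (fun r => f (i :: r)).
Proof. by move=> fC a b r r'; exact: (fC (i :: a)). Qed.

(** [s i] shortens [word (j :: q)]. The letter deleted by exchange is not the leading [j], as this
    would give [s i = s j]. *)
Lemma reduced_consl i p j q : i != j -> reduced (i :: p) -> reduced (j :: q) ->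
  word (i :: p) = word (j :: q) ->
  exists2 c, size q = (size c).+1 & word (i :: p) = word [:: i, j & c].
Proof.
move=> ij ri rj e; have rp : reduced p by exact: (@reduced_catr _ _ [:: i]).
have lt : (ell (s i * word (j :: q)) < ell (word (j :: q)))%N.
  by rewrite -e (eqP ri) of_word_cons simple_genKl (eqP rp).
have [[|k a] [l [b [[jk qE] ib]]]] := left_exchange lt.
  case/eqP: ij; apply/simple_gen_inj/(mulIg (word (j :: q))).
  by rewrite ib -qE of_word_cons simple_genKl.
exists (a ++ b); first by rewrite qE !size_cat /= addnS.
by rewrite e [RHS]of_word_cons [in RHS]jk -[word (k :: a ++ b)]ib simple_genKl.
Qed.

(** Exchange for [s j] in [[:: i, j & c]]: deleting [i] makes the element too short, and deleting
    [j] forces [s i = s j] by the braid relation, so the deleted letter lies in [c]. *)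
Lemma reduced_adjacent i j q c : braid_rel C [:: i; j; i] [:: j; i; j] ->
  i != j -> reduced (j :: q) -> word (j :: q) = word [:: i, j & c] ->
  size q = (size c).+1 ->
  exists2 d, size c = (size d).+1 & word (j :: q) = word [:: j, i, j & d].
Proof.
move=> /braid_rel_word br ij rj e sz; move: br.
rewrite !of_word_cons of_word_nil !mulg1 => br.
have lt : (ell (s j * word [:: i, j & c]) < ell (word [:: i, j & c]))%N.
  rewrite -e (eqP rj) of_word_cons simple_genKl.
  by rewrite (eqP (@reduced_catr _ _ [:: j] q rj)).
have sij : s i <> s j by move=> /simple_gen_inj /eqP; apply/negP.
have [[|k [|k' a]] [l [b [cE jc]]]] := left_exchange lt; case: cE.
- move=> _ bE; move: jc e; rewrite -bE !of_word_cons => /mulgI ->.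
  rewrite -of_word_cons => e; have := ell_min C c.
  by rewrite -e (eqP rj) /= sz; lia.
- move=> ik _ bE; move: jc; rewrite -bE -ik !of_word_cons => jc.
  have : s j * (s i * s j) = s i by apply: (mulIg (word c)); rewrite -!mulgA jc.
  rewrite -br -[in RHS](mulg1 (s i)) => /mulgI /mulg1_eq.
  by rewrite simple_genV => /esym /sij.
- move=> ik jk' cE; exists (a ++ b); first by rewrite cE !size_cat /= addnS.
  rewrite -!of_word_cons [RHS]of_word_cons; move: jc; rewrite -ik -jk' => <-.
  by rewrite -e simple_genKl.
Qed.

(** Words with first letters [i] and [j] are compared, by induction, with words that begin with the
    two sides of the braid relation of [i] and [j]. Without braid relations, reduced words are
    unique. *)
Lemma word_property (T : Type) (f : seq 'I_n -> T) r r' :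
  (forall i j, i != j ->
     (C i j = 0 /\ C j i = 0) \/ (C i j = -1 /\ C j i = -1))%R
    \/ (forall r r', ~ braid_rel C r r') ->
  braid_invariant f -> reduced r -> reduced r' -> word r = word r' ->
  f r = f r'.
Proof.
move=> [laced|nobraid] fC rr rr' e; last first.
  congr f; rewrite -(reduced_free_reduction rr) -(reduced_free_reduction rr').
  exact/free_reduction_eq/of_wordP.
move: {2}(size r) (erefl (size r)) => m.
(* [f] varies in the induction so that a common first letter can be absorbed into it. *)
elim: m => [|m IH] in r r' f fC rr rr' e *.
  case: r e rr => // e _ _; move: rr'.
  by rewrite /reduced -e of_word_nil ell1; case: r' {e}.
case: r e rr => [//|i p] e ri [sp]; case: r' e rr' => [|j q] e rj.
  by move: ri; rewrite /reduced e of_word_nil ell1.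
have rp : reduced p by exact: (@reduced_catr _ _ [:: i]).
have rq : reduced q by exact: (@reduced_catr _ _ [:: j]).
have IHc k p' q' : size p' = m -> reduced p' -> reduced q' ->
    word p' = word q' -> f (k :: p') = f (k :: q').
  by move=> sp' rp' rq' e'; exact: (IH p' q' _ (braid_invariant_cons k fC)).
have sq : size q = m by move: (eqP rj); rewrite -e (eqP ri) /= sp => -[].
have red c : size c = m -> word c = word p \/ word c = word q -> reduced c.
  by rewrite /reduced => -> [] ->; rewrite 1?(eqP rp) 1?(eqP rq) ?sp ?sq.
have [ij|ij] := eqVneq i j.
  rewrite -ij in e *; apply: IHc => //.
  by move: e; rewrite !of_word_cons => /mulgI.
have tl k a b : word (k :: a) = word (k :: b) -> word a = word b.
  by rewrite !of_word_cons => /mulgI.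
have [c sc wc] := reduced_consl ij ri rj e; rewrite sq in sc.
have qij : word (j :: q) = word [:: i, j & c] by rewrite -e.
case: (laced i j ij) => -[Cij Cji].
  have ijc : word [:: i, j & c] = word [:: j, i & c].
    have := braid_rel_word (BraidCommute Cij Cji).
    by rewrite !of_word_cons of_word_nil !mulg1 !mulgA => ->.
  have pc := tl _ _ _ wc; have qc : word q = word (i :: c).
    by apply: (tl j); rewrite qij.
  rewrite (IHc i p (j :: c)) ?(IHc j q (i :: c)) //;
    try by apply: red => //=; auto.
  exact: (fC [::] c _ _ (BraidCommute Cij Cji)).
have br := BraidAdjacent Cij Cji.
have [d sd wd] : exists2 d, size c = (size d).+1 &
    word (j :: q) = word [:: j, i, j & d].
  by apply: reduced_adjacent (BraidAdjacent Cij Cji) ij rj qij _; rewrite sq sc.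
have qd := tl _ _ _ wd; have pd : word p = word [:: j, i & d].
  apply: (tl i); rewrite e wd.
  have := braid_rel_word br.
  by rewrite !of_word_cons of_word_nil !mulg1 !mulgA => ->.
rewrite (IHc i p [:: j, i & d]) ?(IHc j q [:: i, j & d]) //;
  try by apply: red => //=; rewrite ?sc ?sd; auto.
exact: (fC [::] d _ _ br).
Qed.

End WordProperty.

(** * Products of basis elements of the nilCoxeter algebra *)

Section NilCoxeterProducts.
Local Open Scope ring_scope.
Variables (R : comNzRingType) (n : nat) (C : 'M[int]_n).
Hypothesis C2 : forall i, C i i = 2.
Hypothesis C_laced :
  (forall i j, i != j ->
     (C i j = 0 /\ C j i = 0) \/ (C i j = -1 /\ C j i = -1)) \/
  (forall r r', ~ braid_rel C r r').
Local Notation u := (@u_gen R n C).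
Local Arguments ell {n C} x%_g.

Lemma prod_u_gen_reduced r : reduced C r ->
  \prod_(i <- r) u i = u_ R (of_word C r).
Proof.
move=> rr; rewrite /u_.
apply: (word_property C2 (f := fun r => \prod_(i <- r) u i)) => //.
- by move=> a b r1 r2 h; rewrite !big_cat /= (u_gen_braid _ h).
- exact: reduced_word_reduced.
- by rewrite of_reduced_word.
Qed.

(** Where a letter [i] first lowers the length, the prefix before it also has a reduced word ending
    in [i], so [u i * u i] appears. *)
Lemma prod_u_gen_not_reduced r : ~~ reduced C r -> \prod_(i <- r) u i = 0.
Proof.
move=> /not_reduced_prefix[a [i [b [-> ra lt]]]].
pose z := tval (reduced_word (of_word C a * simple_gen C i)%g).
have az : of_word C (rcons z i) = of_word C a.
  by rewrite of_word_rcons of_reduced_word simple_genK.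
have rz : reduced C (rcons z i).
  rewrite /reduced az size_rcons size_tuple.
  by have := ell_mul_gen (of_word C a) i; move: lt; lia.
rewrite big_cat big_cons /= (prod_u_gen_reduced ra) -az.
rewrite -(prod_u_gen_reduced rz).
rewrite -cats1 big_cat /= big_seq1 -!mulrA.
by rewrite (mulrA (u i)) u_gen_square mul0r mulr0.
Qed.

Lemma u_mul (x y : coxeter C) :
  u_ R x * u_ R y =
    if ell (x * y) == (ell x + ell y)%N then u_ R (x * y)%g else 0.
Proof.
rewrite /u_ -big_cat -{2}(size_tuple (reduced_word x)).
rewrite -{2}(size_tuple (reduced_word y)) -size_cat.
have : of_word C (reduced_word x ++ reduced_word y) = (x * y)%g.
  by rewrite of_word_cat !of_reduced_word.
move: (_ ++ _) => r <-; case: ifP => [|/negbT].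
  exact: prod_u_gen_reduced.
exact: prod_u_gen_not_reduced.
Qed.

End NilCoxeterProducts.

(** * Real roots and the coroots of covers *)

Section Roots.
Local Open Scope ring_scope.
Variables (n : nat) (C : 'M[int]_n).
Hypothesis C2 : forall i, C i i = 2.
Hypothesis C_sym : forall i j, C i j = C j i.
Local Notation W := (coxeter C).
Local Notation s := (simple_gen C).
Implicit Types (x y u v t : W) (lam mu : 'rV[int]_n).

Lemma nonneg_opp (a b : int) : 0 <= a -> 0 <= b -> a = - b -> a = 0 /\ b = 0.
Proof. lia. Qed.

Lemma pairingC mu lam : pairing C mu lam = pairing C lam mu.
Proof.
rewrite /pairing -[in LHS](trmxK (mu *m C *m _)) mxE !trmx_mul trmxK mulmxA.
by congr ((_ *m _ *m _) _ _); apply/matrixP => i j; rewrite mxE.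
Qed.

Lemma coact_act x mu : coact x mu = act x mu.
Proof.
rewrite /coact /act; elim: (repr x) => //= i r ->.
by rewrite /coroot_refl /root_refl pairingC.
Qed.

Lemma actM x y lam : act (x * y)%g lam = act x (act y lam).
Proof.
rewrite -(of_word_repr x) -(of_word_repr y) -of_word_cat !act_of_word //.
by rewrite foldr_cat.
Qed.

Lemma act1 lam : act (1 : W)%g lam = lam.
Proof. by rewrite (act_of_word [::]). Qed.

Lemma act_gen i lam :
  act (s i) lam = lam - pairing C (simple i) lam *: simple i.
Proof. by rewrite (act_of_word [:: i]). Qed.

Lemma act_gen_simple i : act (s i) (simple i) = - simple i.
Proof.
rewrite act_gen pairing_simple C2; apply/rowP => l; rewrite !mxE; ring.
Qed.

Lemma act_linear x : linear (act x).
Proof.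
move=> c; rewrite /act => lam mu; elim: (repr x) => //= i r ->.
rewrite /root_refl ![pairing C (simple i) _]pairingC.
have -> a b : pairing C (c *: a + b) (simple i) =
    c * pairing C a (simple i) + pairing C b (simple i).
  by rewrite /pairing !mulmxDl -!scalemxAl !mxE.
by apply/rowP => l; rewrite !mxE; ring.
Qed.

HB.instance Definition _ x :=
  GRing.isLinear.Build int 'rV[int]_n 'rV[int]_n *:%R (act x) (act_linear x).

Lemma pairing_act x lam mu :
  pairing C (act x lam) (act x mu) = pairing C lam mu.
Proof.
rewrite /act; elim: (repr x) => //= i r IH; rewrite /root_refl -[RHS]IH.
rewrite pairingBZl !pairingBZr pairing_simple C2.
rewrite (pairingC _ (simple i)); ring.
Qed.

Lemma act_reflection u i lam : act (u * s i * u^-1)%g lam =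
  lam - pairing C (act u (simple i)) lam *: act u (simple i).
Proof.
have uK mu : act u (act u^-1%g mu) = mu by rewrite -actM mulgV act1.
by rewrite !actM act_gen linearB linearZ /= uK -(pairing_act u) uK.
Qed.

(** Both roots have norm 2. Evaluating the reflection at each of them gives [2 b = c b'] and
    [c b = 2 b'] with [c] their pairing, so [c] is 2 or -2. *)
Lemma reflection_root_unique u u' i i' :
  (u * s i * u^-1 = u' * s i' * u'^-1)%g ->
  act u (simple i) = act u' (simple i') \/
  act u (simple i) = - act u' (simple i').
Proof.
set b := act u _; set b' := act u' _ => e.
have bb : pairing C b b = 2 by rewrite pairing_act pairing_simple C2.
have bb' : pairing C b' b' = 2 by rewrite pairing_act pairing_simple C2.
have eq mu : pairing C b mu *: b = pairing C b' mu *: b'.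
  have := act_reflection u i mu; rewrite e act_reflection.
  by move=> /addrI /oppr_inj ->.
have e1 := eq b; have e2 := eq b'; rewrite bb bb' (pairingC b') in e1 e2.
set c := pairing C b b' in e1 e2.
have [l bl] : exists l, b 0 l != 0.
  apply/existsP; apply: contraT; rewrite negb_exists => /forallP b0.
  have : b = 0.
    by apply/rowP => l; rewrite mxE; apply/eqP; have := b0 l; rewrite negbK.
  by move=> b00; move: bb; rewrite b00 /pairing mul0mx mul0mx mxE.
have cc : c = 2 \/ c = - (2 : int).
  have := congr1 (fun m : 'rV_n => m 0 l) e2.
  have := congr1 (fun m : 'rV_n => m 0 l) e1; rewrite !mxE => h1 h2.
  have : (c - 2) * (c + 2) * b 0 l = 0.
    have -> : (c - 2) * (c + 2) * b 0 l = c * (c * b 0 l) - 2 * (2 * b 0 l).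
      by ring.
    by rewrite h1 h2; ring.
  by move=> /eqP; rewrite !mulf_eq0 (negPf bl) orbF => /orP[]/eqP; lia.
case: cc => cE; [left|right]; apply/rowP => m;
  have := congr1 (fun a : 'rV_n => a 0 m) e1; rewrite cE !mxE ?mulNr -?mulrN;
  exact: mulfI.
Qed.

(** For [i != j], the reflection [s i] alters only the [i]-th coordinate. *)
Lemma act_parabolic j v lam : parabolic j v -> act v lam 0 j = lam 0 j.
Proof.
move=> /parabolic_word[r jr ->]; rewrite act_of_word //.
elim: r jr => //= i r IH; rewrite inE negb_or => /andP[ji jr].
by rewrite /root_refl !mxE IH // (negPf ji) andbF mulr0 subr0.
Qed.

(** Real roots are among the vectors of norm 2, since the action preserves the form.
    [affine_coherent] supplies this for affine Cartan matrices. *)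
Hypothesis C_coherent : forall lam, pairing C lam lam = 2 ->
  positive lam || positive (- lam).

Lemma positive_witness t : reflection t -> exists u i,
  t = (u * s i * u^-1)%g /\ positive (act u (simple i)).
Proof.
move=> [v [i ->]]; pose u := v^-1%g.
have tE : (s i ^ v = u * s i * u^-1)%g by rewrite /u conjgE invgK mulgA.
have /C_coherent/orP[up|un] :
  pairing C (act u (simple i)) (act u (simple i)) = 2.
- by rewrite pairing_act pairing_simple C2.
- by exists u, i.
(* The root is negative here; [u * s i] gives the same reflection and the opposite root. *)
exists (u * s i)%g, i; rewrite actM act_gen_simple linearN; split=> //.
by rewrite tE invgM simple_genV !mulgA simple_genK.
Qed.

Lemma cover_corootE x y u i : (x^-1 * y = u * s i * u^-1)%g ->
  positive (act u (simple i)) -> cover_coroot x y = act u (simple i).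
Proof.
move=> e up; rewrite /cover_coroot; case: pselect => [ex|[]]; last first.
  by exists (u, i); rewrite /cover_witness e eqxx.
have /andP[/eqP e' up'] := xchooseP ex; rewrite coact_act.
move: e'; rewrite e => /reflection_root_unique[//|eN].
(* Opposite vectors with nonnegative coordinates both vanish, and are then equal too. *)
suff z : act u (simple i) = 0.
  by move: eN; rewrite z => /eqP; rewrite eq_sym oppr_eq0 => /eqP.
apply/rowP => l; have := congr1 (fun b : 'rV_n => b 0 l) eN.
rewrite [in RHS]mxE => /(nonneg_opp (forallP up l) (forallP up' l))[-> _].
by rewrite mxE.
Qed.

(** Up to sign, [v] maps one coroot to the other and keeps the [j]-th coordinate. As both are
    positive, the sign can only be -1 if that coordinate is 0. *)
Lemma cover_coroot_conj j x y x' y' v : reflection (x^-1 * y)%g ->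
  parabolic j v -> (x'^-1 * y' = v * (x^-1 * y) * v^-1)%g ->
  cover_coroot x y 0 j = cover_coroot x' y' 0 j.
Proof.
move=> rt jv e.
have /positive_witness[u' [i' [e' up']]] : reflection (x'^-1 * y')%g.
  by rewrite e -mulgA -{1}(invgK v); exact: reflectionJ.
have [u [i [eu up]]] := positive_witness rt.
rewrite (cover_corootE eu up) (cover_corootE e' up').
have : (v * u * s i * (v * u)^-1 = u' * s i' * u'^-1)%g.
  by rewrite -e' e eu invgM !mulgA.
move=> /reflection_root_unique; rewrite actM => -[] h;
  have := congr1 (fun b : 'rV_n => b 0 j) h; rewrite act_parabolic //.
by rewrite mxE => /(nonneg_opp (forallP up j) (forallP up' j))[-> ->].
Qed.

Lemma cover_coroot_parabolic j x y u i : parabolic j u -> i != j ->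
  (x^-1 * y = u * s i * u^-1)%g -> cover_coroot x y 0 j = 0.
Proof.
move=> ju ij e.
have rt : reflection (x^-1 * y)%g.
  by exists u^-1%g, i; rewrite conjgE invgK mulgA.
have [u' [i' [e' up']]] := positive_witness rt.
have ui : act u (simple i) 0 j = 0.
  by rewrite act_parabolic // mxE eq_sym (negPf ij) andbF.
rewrite (cover_corootE e' up').
move: e'; rewrite e => /reflection_root_unique[<-//|h].
by move: ui; rewrite h mxE => /eqP; rewrite oppr_eq0 => /eqP.
Qed.

End Roots.

(** * Sign coherence of real roots *)

Section AffineRoots.
Local Open Scope ring_scope.
Variable k : nat.
Local Notation next := (@ordS k.+1).
Implicit Types (i l : 'I_k.+1) (f g : 'I_k.+1 -> int).

(* Half the square norm in A_k^(1). It is positive semidefinite, and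
   superadditive on the decomposition of f into positive and negative parts. If
   it is 1 on f, then it vanishes on one of the two parts, which is therefore
   constant. *)
Definition cycle_form f : int := \sum_i (f i * f i - f i * f (next i)).

Lemma cycle_form_sq f : cycle_form f *+ 2 = \sum_i (f i - f (next i)) ^+ 2.
Proof.
rewrite /cycle_form mulr2n.
have e : \sum_i f i * f i = \sum_i f (next i) * f (next i).
  by rewrite (reindex_inj (@ordS_inj k.+1)).
rewrite {1}sumrB e -!sumrB -big_split /=; apply: eq_bigr => i _; ring.
Qed.

Lemma cycle_form_ge0 f : 0 <= cycle_form f.
Proof.
have : 0 <= cycle_form f *+ 2.
  by rewrite cycle_form_sq sumr_ge0 // => i _; exact: sqr_ge0.
lia.
Qed.

Lemma cycle_form0 f : cycle_form f = 0 -> forall i, f i = f ord0.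
Proof.
move=> f0; have := cycle_form_sq f; rewrite f0 mul0rn => /esym/eqP.
rewrite psumr_eq0 => [/allP fn|i _]; last exact: sqr_ge0.
have step i : f i = f (next i).
  by have := fn i (mem_index_enum i); rewrite sqrf_eq0 subr_eq0 => /eqP.
move=> [m mk]; elim: m mk => [|m IH] mk; first by congr f; apply: val_inj.
rewrite -(IH (ltnW mk)) [RHS]step; congr f; apply: val_inj => /=.
by rewrite (modn_small mk).
Qed.

Lemma cycle_form_coherent f : cycle_form f = 1 ->
  (forall i, 0 <= f i) \/ (forall i, f i <= 0).
Proof.
pose p i := Num.max (f i) 0; pose q i := Num.max (- f i) 0.
(* This holds termwise: [f = p - q] with [p i * q i = 0], and the remaining cross terms are products
   of nonnegative numbers. *)
move=> f1; have : cycle_form p + cycle_form q <= 1.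
  rewrite -f1 /cycle_form -big_split /=; apply: ler_sum => i _.
  rewrite /p /q; have := f i; have := f (next i); nia.
have := cycle_form_ge0 p; have := cycle_form_ge0 q => q0 p0 pq.
have [] : cycle_form p = 0 \/ cycle_form q = 0 by lia.
  move=> /cycle_form0 h; have [f0|f0] := lerP (f ord0) 0.
    by right=> i; have := h i; rewrite /p; lia.
  by left=> i; have := h i; rewrite /p; lia.
move=> /cycle_form0 h; have [f0|f0] := lerP 0 (f ord0).
  by left=> i; have := h i; rewrite /q; lia.
by right=> i; have := h i; rewrite /q; lia.
Qed.

Lemma next_modE i l : next_mod i l = (l == next i).
Proof.
rewrite /next_mod -val_eqE /=.
by rewrite [in LHS](modn_small (ltn_ord l)).
Qed.

(** Row [i] of the matrix sends [lam] to twice its [i]-th coordinate minus its two neighbours. For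
    [k = 1] the neighbours coincide, in accordance with the entry -2. *)
Lemma pairing_cycle (lam : 'rV[int]_k.+1) :
  pairing (cartan_cycle k) lam lam = cycle_form (fun i => lam 0 i) *+ 2.
Proof.
rewrite /pairing -mulmxA mxE.
have nb i l : (next l == i) = (l == ord_pred i).
  by rewrite (can2_eq (@ordSK k.+1) (@ord_predK k.+1)).
have row i : (cartan_cycle k *m lam^T) i 0 =
    lam 0 i *+ 2 - lam 0 (next i) - lam 0 (ord_pred i).
  rewrite mxE (eq_bigr (fun l => (l == i)%:R * lam 0 l *+ 2 -
    (l == next i)%:R * lam 0 l - (l == ord_pred i)%:R * lam 0 l)) => [|l _].
    rewrite !sumrB sumrMnl.
    have dl j : \sum_l (l == j)%:R * lam 0 l = lam 0 j.
      rewrite (bigD1 j) //= eqxx mul1r big1 ?addr0 // => l /negPf ->.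
      by rewrite mul0r.
    by rewrite !dl.
  rewrite !mxE !next_modE -nb (eq_sym l i) (eq_sym (next l)).
  rewrite !pmulrn; ring.
rewrite (eq_bigr _ (fun i _ => congr1 (fun z => lam 0 i * z) (row i))).
rewrite /cycle_form !sumrB mulrnBl.
rewrite (eq_bigr (fun i => lam 0 i * lam 0 i *+ 2 - lam 0 i * lam 0 (next i) -
  lam 0 i * lam 0 (ord_pred i))) => [|i _]; last by ring.
rewrite !sumrB sumrMnl.
have -> : \sum_i lam 0 i * lam 0 (ord_pred i) = \sum_i lam 0 i * lam 0 (next i).
  rewrite (reindex_inj (@ordS_inj k.+1)); apply: eq_bigr => i _.
  by rewrite ordSK mulrC.
by rewrite -addrA -opprD -mulr2n.
Qed.

Lemma affine_coherent (C : 'M[int]_k.+1) lam : (0 < k)%N -> affine_cartan C ->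
  pairing C lam lam = 2 -> positive lam || positive (- lam).
Proof.
move=> k0 affC; have cyc : C = cartan_cycle k -> pairing C lam lam = 2 ->
    positive lam || positive (- lam).
  move=> -> ; rewrite pairing_cycle => e.
  have [|h|h] := @cycle_form_coherent (fun i => lam 0 i); first by lia.
    by apply/orP; left; apply/forallP.
  by apply/orP; right; apply/forallP => i; rewrite mxE oppr_ge0.
case: affC => [CE|/cyc //]; have [k1|k1] := ltnP 1 k.
  by apply: cyc; rewrite cartan_cycleE.
(* What remains is [cartan_adj 1], of finite type A_2, with form [2 (a^2 - a b + b^2)]: the value 2
   excludes opposite signs. *)
have {k0 cyc} k1 : k = 1%N by lia.
rewrite {}CE; subst k; rewrite /pairing -mulmxA mxE !big_ord_recl big_ord0.
rewrite !mxE !big_ord_recl !big_ord0 !mxE.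
have [a01 a10] : adjacent ord0 (lift ord0 ord0 : 'I_2) /\
  adjacent (lift ord0 ord0 : 'I_2) ord0 by [].
rewrite a01 a10 /= !addr0; set a := lam 0 ord0; set b := lam 0 (lift ord0 ord0).
have all2 (P : 'I_2 -> Prop) : P ord0 -> P (lift ord0 ord0) ->
    forall l : 'I_2, P l.
  by move=> P0 P1 l; case: (unliftP ord0 l) => [m|] -> //; rewrite (ord1 m).
have coh (c d : int) : c * (2 * c + -1 * d) + d * (-1 * c + 2 * d) = 2 ->
  (0 <= c /\ 0 <= d) \/ (c <= 0 /\ d <= 0) by nia.
move=> /coh[[a0 b0]|[a0 b0]]; apply/orP; [left|right]; apply/forallP;
  apply: all2;
  by rewrite // mxE oppr_ge0.
Qed.

End AffineRoots.

(** * Covers of [w * v] *)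

Section ParabolicCovers.
Local Open Scope group_scope.
Variables (n : nat) (C : 'M[int]_n) (j : 'I_n) (w v : coxeter C).
Hypotheses (wmin : min_coset_rep j w) (jv : parabolic j v).
Local Arguments ell {n C} x%_g.

Lemma cover_mul_parabolic x : bruhat_cover x (w * v) ->
  (exists u i, [/\ parabolic j u, i != j
     & x^-1 * (w * v) = u * simple_gen C i * u^-1]) \/
  bruhat_cover (x * v^-1) w.
Proof.
move=> /bruhat_coverP[lx [t rt yE]].
have xE : x = w * v * t by rewrite yE -mulgA reflection_sq // mulg1.
have tE : x^-1 * (w * v) = t by rewrite yE mulKg.
have [r jr [vE red]] := min_coset_rep_reduced wmin jv.
have wvE : of_word C (reduced_word w ++ r) = w * v.
  by rewrite of_word_cat of_reduced_word -vE.
have := @strong_exchange _ _ (reduced_word w ++ r) t rt.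
rewrite wvE -xE lx => /(_ (leqnn _))[c [i [b [e ti xcb]]]].
case: (cat_eq_cat_cons e) => [[c' _ rE]|[d wE bE]]; [left|right].
  move: jr; rewrite rE mem_cat inE !negb_or => /and3P[_ ji jb].
  exists (of_word C b)^-1, i; split; first exact/ParabolicInv/word_parabolic.
    by rewrite eq_sym.
  by rewrite tE ti conjgE invgK mulgA.
have xv : x * v^-1 = of_word C (c ++ d).
  by rewrite xcb bE catA of_word_cat -vE mulgK.
apply/bruhat_coverP; split.
  (* Deleting a letter bounds the length of [x * v^-1] above by [ell w - 1]; a smaller value would
     make [x] too short. *)
  have := ell_min C (c ++ d); rewrite -xv => lxv.
  have := size_tuple (reduced_word w); rewrite wE => lw.
  have := ell_mul (x * v^-1) v; rewrite mulgVK.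
  move: lx lxv lw; rewrite (min_coset_rep_ell wmin jv) !size_cat /=; lia.
exists (t ^ v^-1); first exact: reflectionJ.
by rewrite conjgE invgK !mulgA mulgVK -yE mulgK.
Qed.

Lemma cover_mulr x : bruhat_cover x w -> ell (x * v) = (ell x + ell v)%N ->
  bruhat_cover (x * v) (w * v).
Proof.
move=> /bruhat_coverP[lx [t rt wE]] lxv; apply/bruhat_coverP; split.
  by rewrite lxv (min_coset_rep_ell wmin jv) lx.
exists (t ^ v); first exact: reflectionJ.
by rewrite conjgE !mulgA mulgK wE.
Qed.

Lemma cover_mulr_ell x : bruhat_cover x w -> bruhat_cover (x * v) (w * v) ->
  ell (x * v) = (ell x + ell v)%N.
Proof.
move=> /bruhat_coverP[lx _] /bruhat_coverP[].
by rewrite (min_coset_rep_ell wmin jv) lx addSn => -[].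
Qed.

End ParabolicCovers.

(** * Affine Cartan matrices *)

Lemma affine_sym (k : nat) (C : 'M[int]_k.+1) : affine_cartan C ->
  forall i j, C i j = C j i.
Proof.
move=> [] -> i j; rewrite !mxE ?(eq_sym j i); last by rewrite addrAC.
by rewrite /adjacent orbC.
Qed.

(** The second alternative serves [cartan_cycle 1]: its off-diagonal entries are -2, whereas
    [braid_rel] asks for 0 or -1. *)
Lemma affine_laced (k : nat) (C : 'M[int]_k.+1) :
  (0 < k)%N -> affine_cartan C ->
  (forall i j, i != j ->
     (C i j = 0 /\ C j i = 0) \/ (C i j = -1 /\ C j i = -1))%R \/
  (forall r r', ~ braid_rel C r r').
Proof.
move=> k0 affC.
have [CE|] : C = cartan_adj k \/ (k = 1%N /\ C = cartan_cycle k).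
  case: affC => CE; [by left|]; have [k1|k1] := ltnP 1 k.
    by left; rewrite CE cartan_cycleE.
  by right; split=> //; lia.
  left=> i j ij; rewrite (affine_sym affC j i) CE mxE (negPf ij).
  by case: ifP => _; [right|left].
move=> {k0 affC} [k1 CE]; subst k; right=> r r' rr'.
have C2 i j : C i j = (if i == j then 2 else - 2)%R.
  rewrite CE mxE; case: i => [[|[|//]] i2]; case: j => [[|[|//]] j2] //.
by case: rr' => i j; rewrite C2; case: ifP.
Qed.

(** * Comparison of the two sums over covers *)

Local Open Scope ring_scope.

Lemma fsum_mulr (A : pzRingType) (T : choiceType) (P : set T) (F : T -> A) a :
  finite_set P -> (\sum_(x \in P) F x) * a = \sum_(x \in P) F x * a.
Proof. by move=> Pfin; rewrite !fsbig_finite // mulr_suml. Qed.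

Lemma fsum_widen (V : nmodType) (T : choiceType) (P D : set T) (F : T -> V) :
  (P `<=` D)%classic -> (forall x, D x -> ~ P x -> F x = 0) ->
  \sum_(x \in D) F x = \sum_(x \in P) F x.
Proof.
move=> PD F0; apply/esym/fsbig_widen => // x [Dx Px]; exact: F0.
Qed.

Theorem theorem3p10 (R : comNzRingType) (k : nat) (hk : (0 < k)%N)
  (C : 'M[int]_k.+1) (hC : affine_cartan C) (j : 'I_k.+1)
  (w v : coxeter C) (hw : min_coset_rep j w) (hv : parabolic j v) :
  down (fund_weight j) (u_ R (w * v)%g) =
  down (fund_weight j) (u_ R w) * u_ R v.
Proof.
have C2 := affine_cartan_diag hk hC; have Csym := affine_sym hC.
have Ccoh lam : pairing C lam lam = 2 -> positive lam || positive (- lam).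
  exact: affine_coherent.
have wpE mu : weight_pairing mu (fund_weight j) = mu 0 j.
  by rewrite /weight_pairing trmx_delta -colE mxE.
have umul := u_mul R C2 (affine_laced hk hC).
(* [D] indexes the terms that the two sides share. *)
pose D := [set x : coxeter C | bruhat_cover x w /\
                               bruhat_cover (x * v)%g (w * v)%g]%classic.
have coefE x : D x ->
    cover_coroot (x * v)%g (w * v)%g 0 j = cover_coroot x w 0 j.
  move=> [_ /bruhat_coverP[_ [t rt e]]].
  have te : ((x * v)^-1 * (w * v) = t)%g by rewrite e mulKg.
  apply: (cover_coroot_conj C2 Csym Ccoh (v := v)) => //; first by rewrite te.
  by rewrite invgM !mulgA mulgV mul1g mulgK.
pose Dv := ((fun x : coxeter C => (x * v)%g) @` D)%classic.
(* On the left, the other covers come from deleting a letter of [v], and their coefficient is 0. *)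
have zeroL x : bruhat_cover x (w * v)%g -> ~ Dv x ->
    ((weight_pairing (cover_coroot x (w * v)%g) (fund_weight j))%:~R : R)
      *: u_ R x = 0.
  move=> xy nD; rewrite wpE.
  have [[u [i [ju ij e]]]|xw] := cover_mul_parabolic hw hv xy.
    by rewrite (cover_coroot_parabolic C2 Csym Ccoh ju ij e) mulr0z scale0r.
  by case: nD; exists (x * v^-1)%g; rewrite /D /= mulgVK.
(* On the right, for the other covers [x] the lengths of [x] and [v] do not add up, so the product
   vanishes. *)
have zeroR x : bruhat_cover x w -> ~ D x ->
    ((weight_pairing (cover_coroot x w) (fund_weight j))%:~R : R)
      *: u_ R x * u_ R v = 0.
  move=> xw nD; rewrite -scalerAl umul; case: eqP => [e|_].
    by case: nD; split=> //; exact: (cover_mulr hw hv xw e).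
  by rewrite scaler0.
rewrite !down_u /down_basis (fsum_mulr _ _ (finite_covers w)).
(* Both sums are cut down to [D], matched by the injective map [x * v]. *)
rewrite (fsum_widen (P := Dv) _ zeroL) => [|_ [x [_ xv] <-] //].
rewrite (fsum_widen (P := D) _ zeroR) => [|x [] //].
rewrite /Dv fsbig_image; last by move=> x y _ _; exact: mulIg.
apply: eq_fsbigr => x /set_mem Dx; have [xw xv] := Dx.
by rewrite !wpE coefE // -scalerAl umul (cover_mulr_ell hw hv xw xv) eqxx.
Qed.
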